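(* Let $\mathcal{H}$ be a reproducing kernel Hilbert space of functions on $\mathcal{X}$ with feature map $\varphi$ satisfying $\|\varphi(x)\|_{\mathcal{H}}\le 1$ for all $x\in\mathcal{X}$, and let $\ell$, $\hat v$, $\boldsymbol\Sigma_v$ be as in the context, with $n_{\min}=\min(n_+,n_-)$. Assume: (1) There exists a unique $v^*\in\mathcal{H}$ such that $\mathbb{E}[\nabla_v\ell(v^* )]=0$ and $\langle v^*,\varphi(x)\rangle\in[0,\pi/2]$ for all $x\in\mathcal{X}$. (2) There is a sequence $\delta_{n_{\min}}>0$, monotonically decreasing as $n_{\min}\to\infty$, such that, with probability tending to $1$ as $n_{\min}\to\infty$, every $v\in\mathcal{H}^*:=\{v\in\mathcal{H}:\|v-v^*\|_{\mathcal{H}}^2\le\delta_{n_{\min}}^2\}$ satisfies $\langle v,\varphi(x)\rangle\in(0,\frac{\pi}{2})$ for all $x\in X_+\cup X_-$. (3) There exists $0<\beta\le1$ such that $v^*\in\mathcal{R}(\boldsymbol\Sigma_{v^*}^{\beta})$, the range of the $\beta$-th fractional power of $\boldsymbol\Sigma_{v^*}$. (4) The minimizer $\hat v$ exists. Then there exist constants $T\ge1$ and $K>0$, not depending on $n_{\min}$, such that the following holds: if $$\lambda=\frac{T}{n_{\min}^{1/4}},\qquad \frac{K}{n_{\min}^{\beta/4}}\le\delta_{n_{\min}}\le\frac{1}{4\max(B_+,B_-)},$$ where $$B_+=\big\|(\boldsymbol\Sigma_{v^*}+\lambda\boldsymbol I)^{-1}\mathbb{E}_{p_+}[\varphi(x)]\big\|_{\mathcal{H}},\qquad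 B_-=\big\|(\boldsymbol\Sigma_{v^*}+\lambda\boldsymbol I)^{-1}\mathbb{E}_{p_-}[\varphi(x)]\big\|_{\mathcal{H}},$$ then there exists a constant $N>0$ such that, when $n_{\min}>N$, $\|\hat v-v^*\|_{\mathcal{H}}=O_p\big(n_{\min}^{-\beta/4}\big)$.
   Context: $X_+=\{x_i^+\}_{i=1}^{n_+}$ and $X_-=\{x_i^-\}_{i=1}^{n_-}$ are independent i.i.d. samples from distributions with densities $p_+$ and $p_-$ on $\mathcal{X}\subseteq\mathbb{R}^d$. $\mathcal{H}$ has positive definite kernel $k(x,x')=\langle\varphi(x),\varphi(x')\rangle$, and for $v\in\mathcal H$, $v(x)=\langle v,\varphi(x)\rangle$. The estimator is $$\hat v:=\operatorname*{argmin}_{v\in\mathcal{H}}\ \ell(v)+\frac{\lambda}{2}\|v\|_{\mathcal{H}}^2\quad\text{subject to}\quad\langle v,\varphi(x)\rangle\in[0,\tfrac{\pi}{2}]\ \ \forall x\in X_+\cup X_-,$$ $$\ell(v):=-\frac1{n_+}\sum_{i=1}^{n_+}\sin\langle v,\varphi(x_i^+)\rangle-\frac1{n_-}\sum_{i=1}^{n_-}\cos\langle v,\varphi(x_i^-)\rangle .$$ Hence $\mathbb{E}[\nabla_v\ell(v)]=-\mathbb{E}_{p_+}[\cos\langle v,\varphi(x)\rangle\varphi(x)]+\mathbb{E}_{p_-}[\sin\langle v,\varphi(x)\rangle\varphi(x)]$. The operator $\boldsymbol\Sigma_v:=\mathbb{E}[\nabla_v^2\ell(v)]$ on $\mathcal{H}$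 is $$\boldsymbol\Sigma_v=\mathbb{E}_{p_+}[\sin\langle v,\varphi(x)\rangle\,\varphi(x)\otimes\varphi(x)]+\mathbb{E}_{p_-}[\cos\langle v,\varphi(x)\rangle\,\varphi(x)\otimes\varphi(x)],$$ where $(\varphi(x)\otimes\varphi(x))u=u(x)\varphi(x)$; $\boldsymbol\Sigma_{v^*}$ is positive, self-adjoint, bounded and compact, and its fractional power is defined spectrally. $\boldsymbol I$ is the identity on $\mathcal{H}$. $Y_n=O_p(a_n)$ means: for every $\varepsilon>0$ there are $M,N_\varepsilon$ with $P(|Y_n|>Ma_n)\le\varepsilon$ for $n\ge N_\varepsilon$. *)

(* Defs.v *)
From HB Require Import structures.
From mathcomp Require Import all_boot all_order all_algebra sesquilinear.
From mathcomp Require Import all_classical all_reals all_analysis.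

Set Implicit Arguments.
Unset Strict Implicit.
Unset Printing Implicit Defensive.
Import Order.TTheory GRing.Theory Num.Theory.
Import numFieldNormedType.Exports.
Local Open Scope classical_set_scope.
Local Open Scope ring_scope.

(* [R^n] is [n.-tuple R] with its product sigma-algebra; Lebesgue measure is
   obtained by iterating the product with one-dimensional Lebesgue measure. *)

Section lebesgue_tuple.
Context {R : realType}.

Definition tcons n (z : measurableTypeR R * n.-tuple R) : n.+1.-tuple R :=
  [tuple of z.1 :: z.2].

Lemma measurable_tcons n : measurable_fun setT (@tcons n).
Proof.
exact: (@measurable_cons _ _ (measurableTypeR R * n.-tuple R)%type R fst n snd).
Qed.

Section step.
Context n (mu : {sigma_finite_measure set (n.-tuple R) -> \bar R}).

Definition lebesgue_tuple_step : set (n.+1.-tuple R) -> \bar R :=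
  pushforward (@lebesgue_measure R \x mu)%E (@tcons n).

Let step_measure : {measure set (n.+1.-tuple R) -> \bar R} :=
  measure_function_pushforward__canonical__measure_function_Measure
    (@lebesgue_measure R \x mu)%E (@measurable_tcons n).

HB.instance Definition _ := isMeasure.Build _ _ _ lebesgue_tuple_step
  (measure0 step_measure) (measure_ge0 step_measure)
  (@measure_semi_sigma_additive _ _ _ step_measure).

Let sigma_finite_step : sigma_finite setT lebesgue_tuple_step.
Proof.
have /sigma_finiteP[F [TF ndF Foo]] := sigma_finiteT (@lebesgue_measure R).
have /sigma_finiteP[G [TG ndG Goo]] := sigma_finiteT mu.
pose u (t : n.+1.-tuple R) : measurableTypeR R * n.-tuple R :=
  (thead t, [tuple of behead t]).
have uK : cancel (@tcons n) u.
  by case=> x t; rewrite /u /tcons theadE; congr pair; exact/val_inj.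
have mthead : measurable_fun setT
    (fun t : n.+1.-tuple R => thead t : measurableTypeR R).
  exact: (@measurable_tnth _ R).
have mbehead : measurable_fun setT (fun t : n.+1.-tuple R => [tuple of behead t]).
  exact: measurable_behead.
have mu_ : measurable_fun setT u by exact: measurable_fun_pair.
exists (fun k => u @^-1` (F k `*` G k)).
  apply/esym/seteqP; split=> // t _.
  have : (\bigcup_k F k) (thead t) by rewrite -TF.
  have : (\bigcup_k G k) [tuple of behead t] by rewrite -TG.
  move=> [j _ Gj] [i _ Fi]; exists (maxn i j) => //; split=> /=.
    by move: (thead t) Fi; exact/subsetPset/ndF/leq_maxl.
  by move: [tuple of behead t] Gj; exact/subsetPset/ndG/leq_maxr.
move=> k; have [mF Fk] := Foo k; have [mG Gk] := Goo k; split.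
  by rewrite -[X in measurable X]setTI; apply: mu_ => //; exact: measurableX.
rewrite /lebesgue_tuple_step /pushforward -comp_preimage.
rewrite (_ : u \o _ = id); last by rewrite funeqE => z; exact: uK.
rewrite preimage_id.
have -> := product_measure1E (@lebesgue_measure R) mu mF mG.
by rewrite lte_mul_pinfty// ge0_fin_numE.
Qed.

HB.instance Definition _ :=
  Measure_isSigmaFinite.Build _ _ _ lebesgue_tuple_step sigma_finite_step.

End step.

Fixpoint lebesgue_tuple n : {sigma_finite_measure set (n.-tuple R) -> \bar R} :=
  if n is n'.+1 then lebesgue_tuple_step (lebesgue_tuple n')
  else \d_([tuple] : 0.-tuple R).

Lemma lebesgue_tuple_setX n (A : set (measurableTypeR R)) (B : set (n.-tuple R)) :
  measurable A -> measurable B ->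
  lebesgue_tuple n.+1 [set t | A (thead t) /\ B [tuple of behead t]] =
  (@lebesgue_measure R A * lebesgue_tuple n B)%E.
Proof.
move=> mA mB; rewrite -(product_measure1E _ _ mA mB)/=; congr product_measure1.
apply/seteqP; split=> -[x t] /=; rewrite /tcons theadE.
  by move=> [Ax Bt]; split=> //=; move: Bt; congr B; exact/val_inj.
by move=> [/= Ax Bt]; split=> //; move: Bt; congr B; exact/val_inj.
Qed.

End lebesgue_tuple.

Section hilbert.
Context {R : realType} {H : completeNormedModType R}.
Variable ip : {dot H for (@idfun R)}.

Definition hilbert_norm := forall u : H, `|u| ^+ 2 = ip u u.

Definition tensor (f u : H) : H := ip u f *: f.

(* [mu i] runs through the nonzero eigenvalues of a positive compact
   self-adjoint [A], repeated according to multiplicity, and possibly through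
   extra zeros; [e i] is only constrained, and only matters, if
   [mu i != 0]. *)
Definition spectral_decomposition (A : H -> H) (e : nat -> H) (mu : nat -> R) :=
  [/\ forall i, 0 <= mu i,
      forall i j, mu i != 0 -> mu j != 0 -> ip (e i) (e j) = (i == j)%:R &
      forall u, series (fun i => (mu i * ip u (e i)) *: e i) @ \oo --> A u].

Definition is_frac_pow (A : H -> H) (b : R) (B : H -> H) :=
  exists e mu, spectral_decomposition A e mu /\
    forall u, series (fun i => (mu i `^ b * ip u (e i)) *: e i) @ \oo --> B u.

(* For [0 < b], [is_frac_pow A b] determines [B] uniquely; [B] exists when [A]
   is positive, self-adjoint and compact. *)
Definition frac_pow (A : H -> H) (b : R) : H -> H :=
  xget (fun=> 0) [set B | is_frac_pow A b B].

(* [(A + lam I)^-1], for [A + lam I] bijective *)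
Definition inv_shift (A : H -> H) (lam : R) : H -> H :=
  'pinv_(fun=> 0) setT (fun u => A u + lam *: u).

(* Expectation of an [H]-valued function restricted to [X], in the weak
   (Pettis) sense, which is the Bochner expectation whenever the latter
   exists. *)
Definition is_mean d (T : measurableType d) (P : {measure set T -> \bar R})
    (X : set T) (f : T -> H) (m : H) :=
  forall u, P.-integrable X (fun x => (ip (f x) u)%:E) /\
            ip m u = \int[P]_(x in X) ip (f x) u.

Definition mean d (T : measurableType d) (P : {measure set T -> \bar R})
    (X : set T) (f : T -> H) : H :=
  xget 0 [set m | is_mean P X f m].

End hilbert.

Definition argmin {R : realType} {V : Type} (C : set V) (F : V -> R) : set V :=
  [set v | C v /\ forall w, C w -> F v <= F w].

Section stochastic.
Context {R : realType} d {Omega : measurableType d} (P : probability Omega R).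

(* Probabilities are outer probabilities [mu_ext P], which agree with [P] on
   measurable events; no measurability of the events is presupposed. *)
Definition with_prob_tending_to_1 (E : nat -> nat -> set Omega) :=
  forall eps : R, 0 < eps -> exists N, forall np nm, (N <= minn np nm)%N ->
    (mu_ext P (~` E np nm) <= eps%:E)%E.

(* [Y = O_p(a)] along [n = minn np nm], restricted to [n > N]. *)
Definition bigOp_above (N : nat) (Y : nat -> nat -> Omega -> R) (a : nat -> R) :=
  forall eps : R, 0 < eps -> exists (M : R) (Neps : nat), forall np nm,
    (N < minn np nm)%N -> (Neps <= minn np nm)%N ->
    (mu_ext P [set w | (M * a (minn np nm) < `|Y np nm w|)%R] <= eps%:E)%E.

Definition independent_samples d' (T : measurableType d') (x y : nat -> Omega -> T) :=
  forall n m (A B : nat -> set T),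
    (forall i, measurable (A i)) -> (forall j, measurable (B j)) ->
    P (\bigcap_(i in `I_n) (x i @^-1` A i) `&` \bigcap_(j in `I_m) (y j @^-1` B j))
    = (\prod_(i < n) P (x i @^-1` A i) * \prod_(j < m) P (y j @^-1` B j))%E.

(* [x i] and [y j], for all [i] and [j], are mutually independent, take their
   values in [X], and follow [Px] and [Py] respectively. *)
Definition iid_samples d' (T : measurableType d') (X : set T)
    (Px Py : probability T R) (x y : nat -> {RV P >-> T}) :=
  [/\ forall i w, X (x i w) /\ X (y i w),
      forall i A, measurable A -> P (x i @^-1` A) = Px A,
      forall i A, measurable A -> P (y i @^-1` A) = Py A &
      independent_samples (fun i => x i : Omega -> T) (fun i => y i : Omega -> T)].

End stochastic.

Definition has_density {R : realType} n (X : set (n.-tuple R))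
    (P : probability (n.-tuple R) R) (p : n.-tuple R -> R) :=
  [/\ measurable_fun X p, forall x, X x -> 0 <= p x &
      forall A, measurable A ->
        P A = (\int[lebesgue_tuple n]_(x in A `&` X) (p x)%:E)%E].

Section rkhs.
Context {R : realType} {H : completeNormedModType R}.
Variables (ip : {dot H for (@idfun R)}).
Context d {T : measurableType d}.
Variables (X : set T) (phi : T -> H).

Definition feval (v : H) (x : T) : R := ip v (phi x).

(* [H] is a space of functions on [X]: a vector is determined by its values
   [feval v x = <v, phi x>], [x \in X]. *)
Definition rkhs :=
  hilbert_norm ip /\
  forall u v, (forall x, X x -> feval u x = feval v x) -> u = v.

Definition rkhs_kernel (x y : T) : R := ip (phi x) (phi y).

Definition measurable_rkhs_kernel :=
  measurable_fun (X `*` X) (fun z : T * T => rkhs_kernel z.1 z.2).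

Section population.
Variables (Pp Pm : probability T R).

(* [mean_grad v] and [Sigma v] are the expectations of the gradient and of the
   Hessian of [loss] at [v]; by identical distribution of the samples they do
   not depend on the sample sizes. *)
Definition mean_grad (v : H) : H :=
  - mean ip Pp X (fun x => cos (feval v x) *: phi x) +
  mean ip Pm X (fun x => sin (feval v x) *: phi x).

Definition Sigma (v u : H) : H :=
  mean ip Pp X (fun x => sin (feval v x) *: tensor ip (phi x) u) +
  mean ip Pm X (fun x => cos (feval v x) *: tensor ip (phi x) u).

Definition is_population_solution (v : H) :=
  mean_grad v = 0 /\ forall x, X x -> 0 <= feval v x <= pi / 2.

Definition Bconst (P : probability T R) (v : H) (lam : R) : R :=
  `|inv_shift (Sigma v) lam (mean ip P X phi)|.

End population.

Section empirical.
Variables (np nm : nat) (xp xm : nat -> T).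

Definition loss (v : H) : R :=
  - (np%:R^-1 * \sum_(i < np) sin (feval v (xp i)))
  - nm%:R^-1 * \sum_(i < nm) cos (feval v (xm i)).

Definition on_sample (Q : T -> Prop) :=
  (forall i, (i < np)%N -> Q (xp i)) /\ (forall i, (i < nm)%N -> Q (xm i)).

Definition feasible : set H :=
  [set v | on_sample (fun x => 0 <= feval v x <= pi / 2)].

Definition estimator (lam : R) : set H :=
  argmin feasible (fun v => loss v + lam / 2 * `|v| ^+ 2).

End empirical.

End rkhs.

(* Main.v *)
(* Write [tau = lambda = n^(-1/4)], [vstar = Sigma^beta u0], and compare the
   estimator with [vstar + w], where [w] is a (truncated) Tikhonov bias solving
   [Sigma w + lambda (vstar + w) ~ 0], so that [|w| <= lambda^beta |u0|].
   The empirical risk is convex on the feasible set and the penalty makes the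
   objective lambda-strongly convex, so only the gradient at [vstar + w] has to
   be controlled.  Its linear part in [w] is a mean of independent vectors, with
   fluctuations of order [n^(-1/2)], and its expectation is cancelled by the
   choice of [w].
   The second-order remainder [<w, phi>^2] is absorbed, sample by sample, by the
   curvature [sin <vstar, phi>] (or [cos]), at the cost of the average of
   [<w, phi>^4 / sin <vstar, phi>].
   Hypothesis (2) keeps [<vstar, phi>] away from [{0, pi/2}] by
   [delta |phi| >= 2 |w| |phi|] on the sample.  If [beta <= 1/2] this bounds that
   average by [<Sigma w, w> <= lambda^(1 + 2 beta) |u0|^2].  If [beta > 1/2],
   hypothesis (2) for samples of size [m^4] shows that the mass of the points at
   relative distance at most [K m^(-beta)] from the boundary is at most [m^(-4)];
   hence the inverse distance is integrable and the average is
   [O_p(|w|^4)], which is [O_p(lambda^(1 + 2 beta))]. *)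
Require Import Defs.
From HB Require Import structures.
From mathcomp Require Import all_boot all_order all_algebra sesquilinear.
From mathcomp Require Import all_classical all_reals all_analysis.
From mathcomp Require Import measurable_realfun ring lra.

Set Implicit Arguments.
Unset Strict Implicit.
Unset Printing Implicit Defensive.
Import Order.TTheory GRing.Theory Num.Theory.
Import numFieldNormedType.Exports.
Local Open Scope classical_set_scope.
Local Open Scope ring_scope.

(** * Inner product spaces and the Riesz representation *)

Section inner_product.
Context {R : realType} {H : completeNormedModType R}.
Variable ip : {dot H for (@idfun R)}.

Lemma ipC u v : ip u v = ip v u.
Proof. by rewrite (@hermitian_subproof _ _ _ _ ip) expr0 mul1r. Qed.

Lemma ipDr w u v : ip w (u + v) = ip w u + ip w v.
Proof. exact: linearDr. Qed.

Lemma ipZr w a u : ip w (a *: u) = a * ip w u.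
Proof. by rewrite linearZr. Qed.

Lemma ip0r w : ip w 0 = 0.
Proof. by rewrite linear0r. Qed.

Lemma ipNr w u : ip w (- u) = - ip w u.
Proof. by rewrite -scaleN1r ipZr mulN1r. Qed.

Lemma ipBr w u v : ip w (u - v) = ip w u - ip w v.
Proof. by rewrite ipDr ipNr. Qed.

Lemma ip_sumr w I (r : seq I) (p : pred I) (F : I -> H) :
  ip w (\sum_(i <- r | p i) F i) = \sum_(i <- r | p i) ip w (F i).
Proof.
by elim/big_rec2: _ => [|i x y _ <-]; rewrite ?ip0r// ipDr.
Qed.

Lemma ipDl w u v : ip (u + v) w = ip u w + ip v w.
Proof. by rewrite !(ipC _ w) ipDr. Qed.

Lemma ipZl w a u : ip (a *: u) w = a * ip u w.
Proof. by rewrite !(ipC _ w) ipZr. Qed.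

Lemma ip0l w : ip 0 w = 0. Proof. by rewrite ipC ip0r. Qed.

Lemma ipNl w u : ip (- u) w = - ip u w.
Proof. by rewrite !(ipC _ w) ipNr. Qed.

Lemma ipBl w u v : ip (u - v) w = ip u w - ip v w.
Proof. by rewrite ipDl ipNl. Qed.

Lemma ip_suml w I (r : seq I) (p : pred I) (F : I -> H) :
  ip (\sum_(i <- r | p i) F i) w = \sum_(i <- r | p i) ip (F i) w.
Proof. by rewrite ipC ip_sumr; apply: eq_bigr => i _; rewrite ipC. Qed.

Hypothesis hn : hilbert_norm ip.

Lemma CauchySchwarz_ip u v : `|ip u v| <= `|u| * `|v|.
Proof.
have [->|v0] := eqVneq v 0; first by rewrite ip0r normr0 mulr_ge0.
have v0' : 0 < `|v| by rewrite normr_gt0.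
rewrite -(ler_pXn2r (n := 2))// ?nnegrE ?mulr_ge0//.
rewrite real_normK ?num_real// exprMn.
(* Scaling by [|v|^2] instead of dividing by it leaves [|v|^2] times the Gram determinant of [u] and
   [v]. *)
have := sqr_ge0 `| `|v| ^+ 2 *: u - ip u v *: v|.
rewrite hn !(ipBl, ipBr, ipZl, ipZr) -!hn (ipC v u).
set q := ip u v; set a := `|u|; set b := `|v|.
rewrite [X in 0 <= X](_ : _ = b ^+ 2 * (a ^+ 2 * b ^+ 2 - q ^+ 2)); last by ring.
by rewrite pmulr_rge0 ?exprn_gt0// subr_ge0.
Qed.

Lemma continuous_ip u : continuous (ip u).
Proof.
move=> v; apply/cvgrPdist_lt => e e0.
near=> w; rewrite -ipBr.
apply: (le_lt_trans (CauchySchwarz_ip _ _)).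
apply: (@le_lt_trans _ _ ((`|u| + 1) * `|v - w|)).
  by rewrite ler_wpM2r// lerDl.
rewrite -ltr_pdivlMl ?ltr_wpDl//.
near: w; apply: cvgr_dist_lt => //.
by rewrite mulr_gt0// invr_gt0 ltr_wpDl.
Unshelve. all: by end_near. Qed.

(* Minimize |v|^2 - 2 L v: the parallelogram identity makes minimizing sequences Cauchy. *)
Lemma riesz_closed_subspace (V : set H) (L : H -> R) (C : R) :
  V 0 -> (forall a u v, V u -> V v -> V (a *: u + v)) ->
  (forall (f : nat -> H) l, (forall n, V (f n)) -> f @ \oo --> l -> V l) ->
  (forall a u v, V u -> V v -> L (a *: u + v) = a * L u + L v) ->
  (forall u, V u -> `|L u| <= C * `|u|) ->
  exists2 m, V m & forall v, V v -> ip m v = L v.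
Proof.
move=> V0 Vlin Vclosed Llin LC.
pose J v := ip v v - 2 * L v.
have JC v : V v -> - C ^+ 2 <= J v.
  move=> Vv; rewrite /J -hn.
  have := LC _ Vv; rewrite ler_norml => /andP[_ LCv].
  have := sqr_ge0 (`|v| - C).
  rewrite sqrrB; lra.
have Jinf : has_inf (J @` V).
  split; first by exists (J 0); exists 0.
  by exists (- C ^+ 2) => _ [v Vv <-]; exact: JC.
set I := inf (J @` V).
have IJ v : V v -> I <= J v.
  by move=> Vv; apply: ge_inf; [case: Jinf | exists v].
have /choice[f Vf] : forall n : nat, exists v, V v /\ J v < I + n.+1%:R^-1.
  move=> n; have [|x [v Vv <-] Jv] := @inf_adherent _ _ (n.+1%:R^-1 : R) _ Jinf.
    by rewrite invr_gt0.
  by exists v.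
have VD u v : V u -> V v -> V (u + v).
  by move=> Vu Vv; rewrite -[u]scale1r; exact: Vlin.
have VZ a u : V u -> V (a *: u).
  by move=> Vu; rewrite -[_ *: _]addr0; exact: Vlin.
have L0 : L 0 = 0.
  have := Llin 1 0 0 V0 V0; rewrite scale1r addr0 mul1r; lra.
have LZ a u : V u -> L (a *: u) = a * L u.
  by move=> Vu; rewrite -[_ *: _]addr0 Llin// L0 addr0.
have LD u v : V u -> V v -> L (u + v) = L u + L v.
  by move=> Vu Vv; rewrite -[u in LHS]scale1r Llin// mul1r.
(* The midpoint of [u] and [v] stays in [V], so [J] is at least [I] there. *)
have parallelogram u v : V u -> V v ->
    `|u - v| ^+ 2 <= 2 * (J u - I) + 2 * (J v - I).
  move=> Vu Vv; have := IJ _ (VZ 2^-1 _ (VD _ _ Vu Vv)).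
  rewrite hn /J LZ ?LD//; last exact: VD.
  rewrite !(ipBl, ipBr, ipZl, ipZr, ipDl, ipDr) (ipC v u); lra.
have cf : cvgn f.
  apply/cauchy_cvgP/cauchy_ballP.
  suff h : forall e : R, 0 < e -> \forall x & y \near f @ \oo, ball x e y by exact: h.
  move=> e e0.
  have e4 : 0 < e ^+ 2 / 4 by rewrite divr_gt0 ?exprn_gt0.
  have [N _ HN] : \forall n \near \oo, n.+1%:R^-1 < e ^+ 2 / 4.
    exact: near_infty_natSinv_lt (PosNum e4).
  exists (f @` [set n | (N <= n)%N], f @` [set n | (N <= n)%N]) => /=.
    by split; exists N => // n Nn; exists n.
  move=> [_ _] [[n /= Nn <-] [m /= Nm <-]].
  rewrite -ball_normE /ball_/= -(ltr_pXn2r (n := 2)) ?nnegrE ?normr_ge0 ?(ltW e0)//.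
  apply: (le_lt_trans (parallelogram _ _ (Vf _).1 (Vf _).1)).
  have := (Vf n).2; have := (Vf m).2.
  have := HN _ Nn; have := HN _ Nm; rewrite /=.
  by move: (m.+1%:R^-1) (n.+1%:R^-1) => x y; lra.
pose m := lim (f @ \oo).
exists m.
  by apply: (Vclosed f) => // n; exact: (Vf n).1.
move=> v Vv.
(* Moving [f n] along [v] by the optimal step [t] lowers [J] by the squared defect over [|v|^2],
   while [J (f n)] is within [1/(n+1)] of the infimum. *)
have key n : (ip v (f n) - L v) ^+ 2 <= `|v| ^+ 2 * n.+1%:R^-1.
  have [->|v0] := eqVneq v 0.
    by rewrite ip0l L0 subrr normr0 expr0n/= mul0r.
  have v2 : 0 < `|v| ^+ 2 by rewrite exprn_gt0// normr_gt0.
  set q := ip v (f n) - L v.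
  pose t := - q / `|v| ^+ 2.
  have := IJ _ (Vlin t _ _ Vv (Vf n).1).
  have := (Vf n).2; rewrite /J Llin//; last exact: (Vf n).1.
  rewrite !(ipDl, ipDr, ipZl, ipZr) (ipC (f n) v) -(hn v).
  set e := n.+1%:R^-1 => Jn JI.
  have : 0 <= e + 2 * t * q + t * t * `|v| ^+ 2 by rewrite /q; lra.
  have -> : e + 2 * t * q + t * t * `|v| ^+ 2 = e - q ^+ 2 / `|v| ^+ 2.
    by rewrite /t; field; rewrite normr_eq0.
  by rewrite subr_ge0 ler_pdivrMr// mulrC.
have lim1 : ip v (f n) @[n --> \oo] --> ip v m.
  by apply: continuous_cvg => //; exact: continuous_ip.
rewrite ipC; apply: (cvg_unique _ lim1) => //.
apply/cvgrPdist_lt => e e0.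
have e2 : 0 < e ^+ 2 / (`|v| ^+ 2 + 1).
  by rewrite divr_gt0 ?exprn_gt0// ltr_wpDl ?sqr_ge0.
have [N _ HN] := near_infty_natSinv_lt (PosNum e2).
exists N => // n /= Nn; have := HN n Nn; rewrite /= => Hn.
rewrite -(ltr_pXn2r (n := 2)) ?nnegrE ?normr_ge0 ?(ltW e0)// distrC.
rewrite real_normK ?num_real//; apply: (le_lt_trans (key n)).
apply: (@le_lt_trans _ _ ((`|v| ^+ 2 + 1) * n.+1%:R^-1)).
  by rewrite ler_wpM2r ?invr_ge0// lerDl.
by rewrite -ltr_pdivlMl ?ltr_wpDl ?sqr_ge0// mulrC.
Qed.

End inner_product.

(** * Local expansion of the sine *)

Section sine_bounds.
Context {R : realType}.
Implicit Types a b s x y : R.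

Lemma is_derive_ge0_le (f df : R -> R) a b : a <= b ->
  (forall x, is_derive x 1 f (df x)) ->
  (forall x, a <= x <= b -> 0 <= df x) -> f a <= f b.
Proof.
move=> ab Df df0.
have cf : {within `[a, b], continuous f}.
  apply: continuous_subspaceT => x.
  exact/differentiable_continuous/derivable1_diffP/ex_derive.
have [c /[!in_itv]/= cab E] := MVT_segment ab (fun x _ => Df x) cf.
by rewrite -subr_ge0 E mulr_ge0 ?df0// subr_ge0.
Qed.

Lemma sin_ge0_pihalf x : 0 <= x <= pi / 2 -> 0 <= sin x.
Proof.
move=> x0; apply: sin_ge0_pi; have := @pi_gt0 R; lra.
Qed.

Lemma xcos_le_sin x : 0 <= x <= pi / 2 -> x * cos x <= sin x.
Proof.
move=> /andP[x0 x1]; rewrite -subr_ge0.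
have /= := @is_derive_ge0_le (fun z => sin z - z * cos z) (fun z => z * sin z) 0 x x0.
rewrite sin0 mul0r subr0; apply => // z.
  apply: is_derive_eq; rewrite /GRing.scale/=; ring.
move=> zx; rewrite mulr_ge0//; first lra.
apply: sin_ge0_pihalf; lra.
Qed.

Lemma sin_double x : sin x = 2 * (sin (x / 2) * cos (x / 2)).
Proof.
have {1}-> : x = (x / 2) *+ 2 by rewrite mulr2n; lra.
by rewrite sin_mulr2n mulr2n; ring.
Qed.

(** Halve the angle: [sin x = 2 sin(x/2) cos(x/2) >= x cos(x/2)^2], and
    [2 cos(x/2)^2 = 1 + cos x >= 1]. *)
Lemma half_le_sin x : 0 <= x <= pi / 2 -> x / 2 <= sin x.
Proof.
move=> xp; have pi0 := @pi_gt0 R.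
have hx : 0 <= x / 2 <= pi / 2 by lra.
have c0 : 0 <= cos (x / 2) by apply: cos_ge0_pihalf; lra.
have cx : 0 <= cos x by apply: cos_ge0_pihalf; lra.
have c2 : 1 <= 2 * cos (x / 2) ^+ 2.
  have : cos ((x / 2) *+ 2) = cos x by congr cos; rewrite mulr2n; lra.
  rewrite cos_mulr2n mulr2n; lra.
rewrite sin_double.
have := ler_wpM2r c0 (xcos_le_sin hx).
have : x / 2 * 1 <= x / 2 * (2 * cos (x / 2) ^+ 2) by rewrite ler_wpM2l//; lra.
rewrite mulr1 expr2; nra.
Qed.

Lemma sin_nondecreasing x y : 0 <= x -> x <= y -> y <= pi / 2 -> sin x <= sin y.
Proof.
move=> x0 xy yp; have pi0 := @pi_gt0 R.
apply: (@is_derive_ge0_le sin cos) => // z xzy.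
apply: cos_ge0_pihalf; lra.
Qed.

Lemma half_sin_le_sin_half s : 0 <= s <= pi / 2 -> sin s / 2 <= sin (s / 2).
Proof.
move=> sp; rewrite sin_double.
have : 0 <= sin (s / 2) by apply: sin_ge0_pihalf; lra.
have := cos_le1 (s / 2); nra.
Qed.

Lemma cos_diff x y : cos x - cos y = 2 * (sin ((x + y) / 2) * sin ((y - x) / 2)).
Proof.
have -> : cos x = cos ((x + y) / 2 - (y - x) / 2) by congr cos; lra.
have -> : cos y = cos ((x + y) / 2 + (y - x) / 2) by congr cos; lra.
rewrite cosB cosD; ring.
Qed.

Let bregman_derive a x : is_derive x 1
  (fun z => sin a - sin z + cos a * (z - a) - sin a / 8 * (z - a) ^+ 2)
  (cos a - cos x - sin a / 4 * (x - a)).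
Proof.
apply: is_derive_eq; rewrite /GRing.scale/=; by field.
Qed.

(* On [0, pi/2] the function - sin is convex; its Bregman divergence at [a]
   stays quadratic with weight [sin a] even when [b] reaches the boundary. *)
Lemma sin_bregman a b : 0 <= a <= pi / 2 -> 0 <= b <= pi / 2 ->
  sin a / 8 * (b - a) ^+ 2 <= sin a - sin b + cos a * (b - a).
Proof.
move=> ap bp; rewrite -subr_ge0; have pi0 := @pi_gt0 R.
have sa0 : 0 <= sin a by exact: sin_ge0_pihalf.
pose G z := sin a - sin z + cos a * (z - a) - sin a / 8 * (z - a) ^+ 2.
have Ga : G a = 0 by rewrite /G; ring.
rewrite -[X in 0 <= X]/(G b) -Ga.
have [ab|ba] := leP a b.
  apply: (is_derive_ge0_le ab (bregman_derive a)) => x axb; rewrite cos_diff.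
  have s1 : sin a <= sin ((a + x) / 2) by apply: sin_nondecreasing; lra.
  have : (x - a) / 2 / 2 <= sin ((x - a) / 2) by apply: half_le_sin; lra.
  nra.
(* To the left of [a] one only has [sin((x+a)/2) >= sin(a/2) >= sin a / 2]; this case fixes the
   constant 8. *)
suff : - G b <= - G a by rewrite lerN2.
apply: (@is_derive_ge0_le (fun z => - G z)
  (fun x => - (cos a - cos x - sin a / 4 * (x - a)))) => [|x|x axb].
- exact: ltW.
- by apply: is_deriveN; exact: bregman_derive.
have s1 : sin a / 2 <= sin ((x + a) / 2).
  apply: (le_trans (half_sin_le_sin_half ap)).
  by apply: sin_nondecreasing; lra.
have s2 : (a - x) / 2 / 2 <= sin ((a - x) / 2) by apply: half_le_sin; lra.
have := cos_diff x a; nra.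
Qed.

(** Negating [s] and [y] together reduces to [0 <= y]. Two monotonicity arguments follow: one shows
    that the sine is 1-Lipschitz, the other integrates that bound. *)
Lemma cos_taylor2 s y : `|cos (s + y) - cos s + y * sin s| <= y ^+ 2 / 2.
Proof.
wlog y0 : s y / 0 <= y => [hw|].
  have [y0|y0] := leP 0 y; first exact: hw.
  have := hw (- s) (- y); rewrite -opprD !cosN sinN mulrNN sqrrN; apply; lra.
pose f z := cos (s + z) - cos s + z * sin s.
have sin_diff (z : R) : 0 <= z -> `|sin s - sin (s + z)| <= z.
  move=> z0.
  rewrite ler_norml; apply/andP; split.
    have /= := @is_derive_ge0_le (fun z => sin s - sin (s + z) + z) (fun z => - (cos (s + z)) + 1) 0 z z0.
    rewrite !addr0 subrr => H.
    have : 0 <= sin s - sin (s + z) + z; last lra.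
    apply: H => [x|x _]; last by rewrite addrC subr_ge0 cos_le1.
    by apply: is_derive_eq; rewrite /GRing.scale/=; ring.
  have /= := @is_derive_ge0_le (fun z => z - sin s + sin (s + z)) (fun z => 1 + cos (s + z)) 0 z z0.
  rewrite !addr0 sub0r addNr => H.
  have : 0 <= z - sin s + sin (s + z); last lra.
  apply: H => [x|x _]; last by have := cos_geN1 (s + x); lra.
  by apply: is_derive_eq; rewrite /GRing.scale/=; ring.
have Df (z : R) : is_derive z 1 f (sin s - sin (s + z)).
  by rewrite /f; apply: is_derive_eq; rewrite /GRing.scale/=; ring.
have f0 : f 0 = 0 by rewrite /f addr0; ring.
rewrite -[X in `|X|]/(f y) ler_norml; apply/andP; split.
  have /= := @is_derive_ge0_le (fun z => f z + z ^+ 2 / 2)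
    (fun z => sin s - sin (s + z) + z) 0 y y0.
  rewrite f0 expr0n/= mul0r addr0 => H.
  have : 0 <= f y + y ^+ 2 / 2; last lra.
  apply: H => [x|x /andP[x0 _]]; last by have := sin_diff x x0; rewrite ler_norml; lra.
  by apply: is_derive_eq; rewrite /GRing.scale/=; field.
have /= := @is_derive_ge0_le (fun z => z ^+ 2 / 2 - f z)
    (fun z => z - (sin s - sin (s + z))) 0 y y0.
rewrite f0 expr0n/= mul0r subr0 => H.
have : 0 <= y ^+ 2 / 2 - f y; last lra.
apply: H => [x|x /andP[x0 _]]; last by have := sin_diff x x0; rewrite ler_norml; lra.
by apply: is_derive_eq; rewrite /GRing.scale/=; field.
Qed.

(* The remainder [y^2/2 |b - s - y|] is absorbed into half of the curvature
   term of [sin_bregman] by AM-GM. *)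
Lemma sin_expansion s y b : 0 < s < pi / 2 -> `|y| <= s / 2 ->
  0 <= s + y <= pi / 2 -> 0 <= b <= pi / 2 ->
  (y * sin s - cos s) * (b - (s + y)) - y ^+ 4 / sin s <=
  sin (s + y) - sin b.
Proof.
move=> sp ys syp bp; set a := s + y; set d := b - a.
have ss0 : 0 < sin s by exact: sin_gt0_pihalf.
have /ler_normlP[ys1 ys2] := ys.
(* Since [|y| <= s / 2], the point [a] stays above [s / 2], and the curvature at [a] is at least
   half of that at [s]. *)
have sa : sin s / 2 <= sin a.
  apply: (le_trans (half_sin_le_sin_half _)); first lra.
  by apply: sin_nondecreasing; rewrite /a; lra.
have B := sin_bregman syp bp; rewrite -/a -/d in B.
have := cos_taylor2 s y; rewrite -/a.
set r := cos a - cos s + y * sin s => rb.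
have E : cos a = r + cos s - y * sin s by rewrite /r; ring.
rewrite E in B.
have rd : r * d <= y ^+ 2 / 2 * `|d|.
  have : `|r * d| <= y ^+ 2 / 2 * `|d| by rewrite normrM ler_wpM2r.
  by rewrite ler_norml => /andP[].
have amgm : y ^+ 2 / 2 * `|d| <= sin s / 16 * d ^+ 2 + y ^+ 4 / sin s.
  rewrite -(real_normK (num_real d)) -subr_ge0.
  have -> : sin s / 16 * `|d| ^+ 2 + y ^+ 4 / sin s - y ^+ 2 / 2 * `|d| =
    sin s / 16 * (`|d| - 4 * y ^+ 2 / sin s) ^+ 2.
    by field; rewrite gt_eqF.
  by rewrite mulr_ge0 ?sqr_ge0 ?divr_ge0 ?ltW.
have : sin s / 16 * d ^+ 2 <= sin a / 8 * d ^+ 2.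
  rewrite ler_wpM2r ?sqr_ge0//; lra.
move: rd amgm B; move: (y ^+ 4 / sin s) (y ^+ 2 / 2 * `|d|) => q t.
lra.
Qed.

End sine_bounds.

(** * The Tikhonov bias *)

Section tikhonov_bias.
Context {R : realType} {H : completeNormedModType R}.
Variable ip : {dot H for (@idfun R)}.
Hypothesis hn : hilbert_norm ip.

(** If [m <= lam] the filter is at most 1 and the power is monotone. Otherwise the filter is at most
    [lam / m], which compensates [(m / lam)^g <= m / lam]; here [g <= 1] is the saturation limit of
    Tikhonov regularization. *)
Lemma tikhonov_filter_le (m lam g : R) : 0 <= m -> 0 < lam -> 0 <= g <= 1 ->
  lam / (m + lam) * m `^ g <= lam `^ g.
Proof.
move=> m0 l0 /andP[g0 g1].
have ml : 0 < m + lam by rewrite ltr_wpDl.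
have [mlam|lamm] := leP m lam.
  have h : lam / (m + lam) <= 1 by rewrite ler_pdivrMr// mul1r lerDr.
  apply: (@le_trans _ _ (1 * m `^ g)).
    by rewrite ler_wpM2r ?powR_ge0.
  by rewrite mul1r ge0_ler_powR// nnegrE// ltW.
have m0' : 0 < m by exact: lt_trans lamm.
have x1 : 1 <= m / lam by rewrite ler_pdivlMr// mul1r ltW.
have mE : m = lam * (m / lam) by rewrite mulrCA divff ?mulr1// gt_eqF.
rewrite {2}mE powRM ?(ltW l0) ?divr_ge0 ?(ltW l0)//.
apply: (@le_trans _ _ (lam / (m + lam) * (lam `^ g * (m / lam)))).
  by rewrite ler_wpM2l ?divr_ge0 ?(ltW l0) ?(ltW ml)// ler_wpM2l ?powR_ge0// ler1_powR.
rewrite mulrCA -[leRHS]mulr1 ler_wpM2l ?powR_ge0//.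
rewrite mulrC mulrA divfK ?gt_eqF// ler_pdivrMr// mul1r lerDl ltW//.
Qed.

(** Bessel's inequality, from the squared norm of the residual of [u]. Null vectors are allowed in
    the family, because vectors attached to a zero eigenvalue will be replaced by 0. *)
Lemma bessel_finite (f : nat -> H) N u :
  (forall i j, ip (f i) (f j) = ((i == j) && (f i != 0))%:R) ->
  \sum_(i < N) ip u (f i) ^+ 2 <= `|u| ^+ 2.
Proof.
move=> fo; have := sqr_ge0 `|u - \sum_(i < N) ip u (f i) *: f i|.
have E : ip u (\sum_(i < N) ip u (f i) *: f i) = \sum_(i < N) ip u (f i) ^+ 2.
  by rewrite ip_sumr; apply: eq_bigr => i _; rewrite ipZr expr2.
have E2 : ip (\sum_(i < N) ip u (f i) *: f i) (\sum_(i < N) ip u (f i) *: f i) =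
    \sum_(i < N) ip u (f i) ^+ 2.
  rewrite ip_suml; apply: eq_bigr => i _; rewrite ipZl ip_sumr (bigD1 i)//=.
  rewrite big1 ?addr0 => [|j ji]; last first.
    by rewrite ipZr fo eq_sym (inj_eq val_inj) (negbTE ji) mulr0.
  rewrite ipZr fo eqxx/= expr2; have [->|] := eqVneq (f i) 0.
    by rewrite ip0r !mul0r.
  by rewrite mulr1.
rewrite hn ipBl !ipBr (ipC ip _ u) E E2 -hn; lra.
Qed.

(** The untruncated candidate is [- lam (A + lam)^-1 v]. Keeping its first [N] spectral coordinates
    makes [A w] a finite sum, cancels those coordinates of [A w + lam (v + w)] exactly, and leaves
    [lam] times a tail of the series of [v]. *)
Lemma tikhonov_bias (A : H -> H) (e : nat -> H) (mu : nat -> R) (b lam : R) u v :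
  spectral_decomposition ip A e mu -> 0 < b <= 1 -> 0 < lam ->
  series (fun i => (mu i `^ b * ip u (e i)) *: e i) @ \oo --> v ->
  exists w, [/\ `|w| <= lam `^ b * `|u|,
    `|A w + lam *: (v + w)| <= lam * lam `^ b &
    b <= 1 / 2 -> ip (A w) w <= lam * (lam `^ b * `|u|) ^+ 2].
Proof.
move=> [mu0 eo Acvg] /andP[b0 b1] l0 vcvg.
(* [e i] is unconstrained when [mu i = 0]. Replacing it by 0 changes no term of either series, as
   its coefficient vanishes (for the power, because [b != 0]). *)
pose f i := if mu i == 0 then 0 else e i.
have fo i j : ip (f i) (f j) = ((i == j) && (f i != 0))%:R.
  rewrite /f; case: (eqVneq (mu i) 0) => [_|mi].
    by rewrite ip0l eqxx andbF.
  case: (eqVneq (mu j) 0) => [mj|mj].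
    by rewrite ip0r; case: eqVneq => // ij; rewrite ij mj eqxx in mi.
  rewrite eo//; case: eqVneq => //= ij.
  case: eqVneq => // ei0; have := eo i i mi mi.
  by rewrite ei0 ip0l eqxx => /eqP; rewrite eq_sym oner_eq0.
have b0' : b != 0 by rewrite gt_eqF.
pose c i := lam / (mu i + lam) * mu i `^ b * ip u (f i).
have fcE x i : (mu i `^ b * ip x (e i)) *: e i = (mu i `^ b * ip x (f i)) *: f i.
  by rewrite /f; case: eqVneq => // ->; rewrite powR0// !mul0r !scale0r.
have fmE x i : (mu i * ip x (e i)) *: e i = (mu i * ip x (f i)) *: f i.
  by rewrite /f; case: eqVneq => // ->; rewrite !mul0r !scale0r.
have lb : 0 < lam * lam `^ b by rewrite mulr_gt0// powR_gt0.
pose S := series (fun i => (mu i `^ b * ip u (f i)) *: f i).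
have Scvg : S @ \oo --> v.
  rewrite (_ : S = series (fun i => (mu i `^ b * ip u (e i)) *: e i))//.
  by congr series; apply/funext => i; rewrite fcE.
(* The truncation index depends on [lam]: the tail has to be below [lam^b] for the residual to be
   below [lam * lam^b]. *)
have [N _ SN] : \forall N \near \oo, `|v - S N| < lam `^ b.
  move/cvgrPdist_lt : Scvg; apply; exact: powR_gt0.
pose w := - \sum_(i < N) c i *: f i.
have ipwf j : ip w (f j) = if (j < N)%N then - c j else 0.
  rewrite /w ipNl ip_suml.
  have [jN|Nj] := ltnP j N; last first.
    rewrite big1 ?oppr0// => i _; rewrite ipZl fo.
    by rewrite ltn_eqF ?(leq_trans (ltn_ord i))//= mulr0.
  rewrite (bigD1 (Ordinal jN))//= big1 ?addr0 => [|i ji]; last first.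
    by rewrite -(inj_eq val_inj)/= in ji; rewrite ipZl fo (negbTE ji) mulr0.
  rewrite ipZl fo eqxx/= /c; have [->|] := eqVneq (f j) 0.
    by rewrite ip0r !mulr0 ?mul0r.
  by rewrite mulr1.
have AwE : A w = \sum_(i < N) (mu i * - c i) *: f i.
  apply: cvg_unique (Acvg w) _ => //.
  apply: cvg_near_cst; exists N => // n /= Nn.
  rewrite /series/= (big_cat_nat (leq0n N) Nn)//= [X in _ + X]big_nat_cond [X in _ + X]big1 ?addr0.
    by rewrite big_mkord; apply: eq_bigr => i _; rewrite fmE ipwf ltn_ord.
  move=> i /andP[/andP[Ni _] _]; rewrite fmE ipwf ltnNge Ni/= mulr0 scale0r//.
have cle (g : R) : 0 <= g <= 1 -> forall i, (lam / (mu i + lam) * mu i `^ g * ip u (f i)) ^+ 2 <=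
    (lam `^ g) ^+ 2 * ip u (f i) ^+ 2.
  move=> g01 i; rewrite exprMn ler_wpM2r ?sqr_ge0// lerXn2r// ?nnegrE ?powR_ge0//.
    by rewrite mulr_ge0 ?powR_ge0// divr_ge0 ?addr_ge0// ltW.
  exact: tikhonov_filter_le.
have wnorm : `|w| ^+ 2 = \sum_(i < N) c i ^+ 2.
  rewrite hn {2}/w ipNr ip_sumr -sumrN; apply: eq_bigr => i _.
  by rewrite ipZr ipwf ltn_ord mulrN opprK expr2.
have bes := @bessel_finite f N u fo.
exists w; split.
- rewrite -(ler_pXn2r (n := 2)) ?nnegrE ?mulr_ge0 ?powR_ge0// wnorm exprMn.
  apply: (@le_trans _ _ (\sum_(i < N) (lam `^ b) ^+ 2 * ip u (f i) ^+ 2)).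
    by apply: ler_sum => i _; apply: cle; rewrite b1 ltW.
  by rewrite -mulr_sumr ler_wpM2l ?sqr_ge0.
- rewrite (_ : _ + _ = lam *: (v - S N)).
    by rewrite normrZ gtr0_norm// ler_pM2l// ltW// SN /=.
  rewrite scalerDr addrCA scalerBr; congr (_ + _).
  rewrite AwE /w scalerN /S /series/= big_mkord !scaler_sumr -!sumrN -big_split/=.
  apply: eq_bigr => i _; rewrite !scalerA -!scaleNr -scalerDl; congr (_ *: _).
  rewrite /c /GRing.scale/=; field.
  by rewrite gt_eqF// ltr_wpDl.
(* The extra factor [mu i] is split into two square roots, so the filter bound is used at exponent
   [b + 1/2], which is at most 1 exactly when [b <= 1/2]. *)
- move=> b2; rewrite AwE ip_suml.
  have powR_half x : 0 <= x -> x `^ (b + 1 / 2) = x `^ b * Num.sqrt x.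
    move=> x0; rewrite powRD ?div1r ?powR12_sqrt//; apply/implyP.
    by rewrite gt_eqF// addr_gt0.
  have -> : lam * (lam `^ b * `|u|) ^+ 2 = (lam `^ (b + 1 / 2)) ^+ 2 * `|u| ^+ 2.
    rewrite exprMn mulrA (powR_half _ (ltW l0)) exprMn sqr_sqrtr ?(ltW l0)//; ring.
  apply: (@le_trans _ _ (\sum_(i < N) (lam `^ (b + 1 / 2)) ^+ 2 * ip u (f i) ^+ 2)).
    apply: ler_sum => i _; rewrite ipZl (ipC ip (f i)) ipwf ltn_ord.
    apply: le_trans (cle (b + 1 / 2) _ i); last by apply/andP; split; lra.
    rewrite powR_half// /c le_eqVlt; apply/orP; left; apply/eqP.
    rewrite [RHS](_ : _ = Num.sqrt (mu i) ^+ 2 *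
      (lam / (mu i + lam) * mu i `^ b * ip u (f i)) ^+ 2); last by ring.
    by rewrite sqr_sqrtr//; ring.
  by rewrite -mulr_sumr ler_wpM2l ?sqr_ge0.
Qed.

End tikhonov_bias.

(** * Concentration of empirical means *)

Section samples.
Context {R : realType} d d' {T : measurableType d} {Omega : measurableType d'}.
Variables (P : probability Omega R) (Q : probability T R).
Variables (X : set T) (mX : measurable X).

Lemma bounded_integrable d0 (S : measurableType d0) (M : probability S R)
    (D : set S) (f : S -> R) (C : R) :
  measurable D -> measurable_fun D f -> (forall x, D x -> `|f x| <= C) ->
  M.-integrable D (EFin \o f).
Proof.
move=> mD mf fC; apply: measurable_bounded_integrable => //.
  by rewrite (le_lt_trans (probability_le1 M mD))// ltry.
exists C; split; first exact: num_real.
by move=> y Cy x Dx; rewrite /= (le_trans (fC x Dx))// ltW.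
Qed.

Lemma Rintegral_sum d0 (S : measurableType d0) (M : {measure set S -> \bar R})
    (D : set S) (I : Type) (r : seq I) (F : I -> S -> R) :
  measurable D -> (forall i, M.-integrable D (EFin \o F i)) ->
  \int[M]_(x in D) (\sum_(i <- r) F i x) = \sum_(i <- r) \int[M]_(x in D) F i x.
Proof.
move=> mD iF; rewrite /Rintegral.
under eq_integral do rewrite -sumEFin.
rewrite integral_sum// sum_fine// => i _.
by apply: integrable_fin_num => //; exact: iF.
Qed.

Lemma Rintegral_le_cst d0 (S : measurableType d0) (M : probability S R)
    (D : set S) (f : S -> R) (C : R) : 0 <= C ->
  measurable D -> measurable_fun D f -> (forall x, D x -> `|f x| <= C) ->
  \int[M]_(x in D) f x <= C.
Proof.
move=> C0 mD mf fC.
apply: (@le_trans _ _ (\int[M]_(x in D) C)).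
  apply: le_Rintegral => //.
  - exact: (bounded_integrable _ mD mf fC).
  - by apply: (bounded_integrable _ (C := `|C|)) => //; exact: measurable_cst.
  - by move=> x Dx; rewrite (le_trans (ler_norm _))// fC.
rewrite Rintegral_cst// ler_piMr// -lee_fin fineK ?probability_le1//.
by rewrite ge0_fin_numE// (le_lt_trans (probability_le1 M mD))// ltry.
Qed.

Lemma markov_outer (Y : Omega -> R) (a b : R) : 0 < a ->
  (forall w, 0 <= Y w) -> measurable_fun setT Y ->
  P.-integrable setT (EFin \o Y) -> \int[P]_w Y w <= b ->
  (mu_ext P [set w | (a < Y w)%R] <= (b / a)%:E)%E.
Proof.
move=> a0 Y0 mY iY Yb.
have mA : measurable [set w | a < Y w].
  have := mY measurableT _ (measurable_itv `]a, +oo[).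
  rewrite setTI; congr measurable; apply/seteqP.
  by split => w /=; rewrite in_itv/= andbT.
rewrite measurable_mu_extE//.
have fA : P [set w | a < Y w] \is a fin_num by exact: fin_num_measure.
rewrite -[X in (X <= _)%E](fineK fA) lee_fin ler_pdivlMr// (le_trans _ Yb)// mulrC.
rewrite -(Rintegral_cst P mA a).
apply: (@le_trans _ _ (\int[P]_(w in [set w | a < Y w]) Y w)).
  apply: le_Rintegral => //.
  - by apply: (bounded_integrable _ (C := `|a|)) => //; exact: measurable_cst.
  - exact: integrableS iY.
  - by move=> w /= /ltW.
rewrite /Rintegral fine_le//.
- by apply: integrable_fin_num => //; exact: integrableS iY.
- exact: integrable_fin_num.
apply: ge0_subset_integral => //; first exact/measurable_EFinP.
by move=> w _; rewrite lee_fin.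
Qed.

(** [f] is measurable on [X] only, so the change of variables is applied to its extension by 0,
    which agrees with [f] along the sample. *)
Lemma integral_law (x : {RV P >-> T}) (f : T -> R) (C : R) :
  (forall w, X (x w)) -> (forall A, measurable A -> P (x @^-1` A) = Q A) ->
  measurable_fun X f -> (forall y, X y -> `|f y| <= C) ->
  \int[P]_w f (x w) = \int[Q]_(y in X) f y.
Proof.
move=> xX xQ mf fC; rewrite [RHS]Rintegral_mkcond.
have mg : measurable_fun setT (f \_ X) by apply/(measurable_restrictT _ mX).
have gE w : (f \_ X) (x w) = f (x w) by rewrite patchE mem_set.
rewrite /Rintegral; congr fine.
transitivity (\int[distribution P x]_y ((f \_ X) y)%:E)%E; last first.
  by apply: eq_measure_integral => A mA _; exact: xQ.
rewrite [RHS](@integral_distribution _ _ _ _ _ P x (EFin \o (f \_ X))).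
- by apply: eq_integral => w _ /=; rewrite gE.
- exact/measurable_EFinP.
- apply: (@bounded_integrable _ _ P _ (fun w => (f \_ X) (x w)) C) => //.
    exact: measurableT_comp.
  by move=> w _; rewrite gE; exact: fC.
Qed.

Lemma measurable_sample (x : {RV P >-> T}) (f : T -> R) :
  (forall w, X (x w)) -> measurable_fun X f -> measurable_fun setT (fun w => f (x w)).
Proof.
move=> xX mf.
rewrite (_ : (fun w => f (x w)) = (f \_ X) \o x).
  by apply: measurableT_comp => //; apply/(measurable_restrictT _ mX).
by apply/funext => w /=; rewrite patchE mem_set.
Qed.

Lemma measurable_sample_pair (x y : {RV P >-> T}) (K : T * T -> R) :
  (forall w, X (x w)) -> (forall w, X (y w)) -> measurable_fun (X `*` X) K ->
  measurable_fun setT (fun w => K (x w, y w)).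
Proof.
move=> xX yX mK.
rewrite (_ : (fun w => K (x w, y w)) = (K \_ (X `*` X)) \o (fun w => (x w, y w))).
  apply: measurableT_comp.
    by apply/(measurable_restrictT _ (measurableX mX mX)).
  exact: measurable_fun_pair.
by apply/funext => w /=; rewrite patchE mem_set//; split; [exact: xX | exact: yX].
Qed.

(** Independence on rectangles identifies the law of the pair with the product measure; Fubini then
    integrates first over the coordinate in which [K] is centred. *)
Lemma integral_law_pair (x y : {RV P >-> T}) (K : T * T -> R) (C : R) :
  (forall w, X (x w)) -> (forall w, X (y w)) ->
  (forall A B, measurable A -> measurable B ->
    P (x @^-1` A `&` y @^-1` B) = (Q A * Q B)%E) ->
  measurable_fun (X `*` X) K ->
  (forall a b, X a -> X b -> `|K (a, b)| <= C) ->
  (forall b, X b -> \int[Q]_(a in X) K (a, b) = 0) ->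
  \int[P]_w K (x w, y w) = 0.
Proof.
move=> xX yX xyQ mK KC K0.
have mXX : measurable (X `*` X) by exact: measurableX.
pose z w := (x w, y w).
have mz : measurable_fun setT z by exact: measurable_fun_pair.
pose zRV : {RV P >-> _} := HB.pack z (isMeasurableFun.Build _ _ _ _ z mz).
have mK' : measurable_fun setT (K \_ (X `*` X)).
  by apply/(measurable_restrictT _ mXX).
have KE w : (K \_ (X `*` X)) (z w) = K (x w, y w).
  by rewrite patchE mem_set//; split; [exact: xX | exact: yX].
have iK : (Q \x Q)%E.-integrable setT (EFin \o (K \_ (X `*` X))).
  apply: (@bounded_integrable _ _ (Q \x Q)%E _ _ `|C|) => //.
  move=> [a b] _; rewrite patchE; case: ifPn => [/set_mem[/= Xa Xb]|_].
    by rewrite (le_trans (KC _ _ Xa Xb))// ler_norm.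
  by rewrite normr0.
have -> : \int[P]_w K (x w, y w) = \int[(Q \x Q)%E]_ab (K \_ (X `*` X)) ab.
  rewrite /Rintegral; congr fine.
  transitivity (\int[distribution P zRV]_ab ((K \_ (X `*` X)) ab)%:E)%E; last first.
    apply: eq_measure_integral => A mA _; apply/esym.
    exact: product_measure_unique.
  rewrite [RHS](@integral_distribution _ _ _ _ _ P zRV (EFin \o (K \_ (X `*` X)))).
  - by apply: eq_integral => w _ /=; rewrite KE.
  - exact/measurable_EFinP.
  - apply: (@bounded_integrable _ _ P _ (fun w => (K \_ (X `*` X)) (z w)) C) => //.
      exact: measurableT_comp.
    by move=> w _; rewrite KE KC.
rewrite /Rintegral -integral21_prod_meas1//.
rewrite integral0_eq// => b _; rewrite /fubini_G.
have [Xb|nXb] := boolP (b \in X); last first.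
  rewrite integral0_eq// => a _ /=; rewrite patchE; case: ifPn => //.
  by move=> /set_mem[/= _ /mem_set]; rewrite (negbTE nXb).
have Xb' := set_mem Xb.
have e1 : (\int[Q]_a ((K \_ (X `*` X)) (a, b))%:E)%E = (\int[Q]_(a in X) (K (a, b))%:E)%E.
  rewrite [RHS]integral_mkcond; apply: eq_integral => a _; rewrite !patchE.
  rewrite in_setX/= Xb andbT; by case: ifP.
rewrite /= e1 -[LHS]fineK; first by have := K0 b Xb'; rewrite /Rintegral => ->.
apply: integrable_fin_num => //.
apply: (@bounded_integrable _ _ Q _ (fun a => K (a, b)) C) => //; last first.
  by move=> a Xa; exact: KC.
have -> : (fun a => K (a, b)) = K \o (fun a => (a, b)) by [].
apply: (measurable_comp mXX) => //.
- by move=> _ [a Xa <-].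
- by apply: measurable_funTS; apply: measurable_pair2.
Qed.

Section sequence.
Variable x : nat -> {RV P >-> T}.
Hypothesis xX : forall i w, X (x i w).
Hypothesis xQ : forall i A, measurable A -> P (x i @^-1` A) = Q A.
Hypothesis x_indep : forall n (A : nat -> set T), (forall i, measurable (A i)) ->
  P (\bigcap_(i in `I_n) (x i @^-1` A i)) = (\prod_(i < n) P (x i @^-1` A i))%E.

Lemma pair_indep i j (A B : set T) : i != j -> measurable A -> measurable B ->
  P (x i @^-1` A `&` x j @^-1` B) = (Q A * Q B)%E.
Proof.
move=> ij mA mB.
(* Independence of a finite initial segment is specialized by putting the whole space at every index
   other than [i] and [j]. *)
pose F k := if k == i then A else if k == j then B else setT.
have mF k : measurable (F k) by rewrite /F; case: ifP => // _; case: ifP.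
have iN : (i < (maxn i j).+1)%N by rewrite ltnS leq_maxl.
have jN : (j < (maxn i j).+1)%N by rewrite ltnS leq_maxr.
have := x_indep (maxn i j).+1 mF.
rewrite (bigD1 (Ordinal iN))//= (bigD1 (Ordinal jN))/=; last first.
  by rewrite -(inj_eq val_inj)/= eq_sym.
rewrite big1 ?mule1 => [|k /andP[ki kj]]; last first.
  move: ki kj; rewrite -!(inj_eq val_inj)/= /F => /negbTE -> /negbTE ->.
  by rewrite preimage_setT probability_setT.
have Fi : F i = A by rewrite /F eqxx.
have Fj : F j = B by rewrite /F eq_sym (negbTE ij) eqxx.
rewrite !xQ// Fi Fj => <-.
congr (P _); apply/seteqP; split => [w [Aw Bw] k _|w h].
  by rewrite /F; case: eqP => [->//|_]; case: eqP => [->//|_].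
by split; [have := h i iN; rewrite Fi | have := h j jN; rewrite Fj].
Qed.

(** The off-diagonal terms have mean zero, so only the [n] diagonal terms contribute. *)
Lemma double_sum_mean_le (K : T * T -> R) (C : R) n :
  measurable_fun (X `*` X) K ->
  (forall a b, X a -> X b -> `|K (a, b)| <= C) ->
  (forall b, X b -> \int[Q]_(a in X) K (a, b) = 0) ->
  0 <= C -> \int[P]_w (\sum_(i < n) \sum_(j < n) K (x i w, x j w)) <= n%:R * C.
Proof.
move=> mK KC K0 C0.
have iK i j : P.-integrable setT (EFin \o (fun w => K (x i w, x j w))).
  apply: (bounded_integrable _ (C := C)) => //.
    exact: measurable_sample_pair.
  by move=> w _; exact: KC.
rewrite Rintegral_sum// => [|i]; last first.
  rewrite (_ : _ \o _ = fun w => (\sum_(j < n) (K (x i w, x j w))%:E)%E).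
    by apply: integrable_sum => // j _; exact: iK.
  by apply/funext => w /=; rewrite sumEFin.
apply: (@le_trans _ _ (\sum_(i < n) C)); last first.
  by rewrite sumr_const card_ord mulr_natl.
apply: ler_sum => i _.
rewrite Rintegral_sum// (bigD1 i)//= big1 ?addr0 => [|j ji].
  apply: Rintegral_le_cst => //; first exact: measurable_sample_pair.
  by move=> w _; exact: KC.
apply: (@integral_law_pair _ _ _ C) => // A B mA mB.
by apply: pair_indep => //; rewrite eq_sym.
Qed.

Lemma empirical_mean_markov (psi : T -> R) (C a : R) n : 0 < a ->
  measurable_fun X psi -> (forall y, X y -> 0 <= psi y <= C) ->
  (mu_ext P [set w | (a < n%:R^-1 * \sum_(i < n) psi (x i w))%R] <=
    ((\int[Q]_(y in X) psi y) / a)%:E)%E.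
Proof.
move=> a0 mpsi psiC.
have pC y : X y -> `|psi y| <= C.
  by move=> /psiC /andP[p0 pC]; rewrite ger0_norm.
have mp i : measurable_fun setT (fun w => psi (x i w)) by exact: measurable_sample.
have ipsi i : P.-integrable setT (EFin \o (fun w => psi (x i w))).
  by apply: (bounded_integrable _ (C := C)) => // w _; exact: pC.
have isum : P.-integrable setT (EFin \o (fun w => \sum_(i < n) psi (x i w))).
  rewrite (_ : _ \o _ = fun w => (\sum_(j < n) (psi (x j w))%:E)%E).
    by apply: integrable_sum => // j _; exact: ipsi.
  by apply/funext => w /=; rewrite sumEFin.
have msum : measurable_fun setT (fun w => n%:R^-1 * \sum_(i < n) psi (x i w)).
  by apply: measurable_funM => //; exact: measurable_sum.
have psi0 : 0 <= \int[Q]_(y in X) psi y.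
  by apply: Rintegral_ge0 => y /psiC /andP[].
apply: markov_outer => //.
- move=> w; rewrite mulr_ge0 ?invr_ge0 ?sumr_ge0// => i _.
  by case/andP: (psiC _ (xX i w)).
- rewrite (_ : _ \o _ = fun w => ((n%:R^-1)%:E * (\sum_(i < n) psi (x i w))%:E)%E).
    exact: integrableZl.
  by apply/funext => w /=; rewrite EFinM.
- rewrite RintegralZl// Rintegral_sum//.
  rewrite (eq_bigr (fun=> \int[Q]_(y in X) psi y)) => [|i _]; last first.
    by apply: (integral_law (xX i) _ mpsi pC) => A; exact: xQ.
  rewrite sumr_const card_ord -[X in _ * X]mulr_natl.
  (* An empty average is 0, since the inverse of 0 is 0. *)
  have [->|n0] := eqVneq n 0%N; first by rewrite mul0r mulr0.
  by rewrite mulrA mulVf ?mul1r// pnatr_eq0.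
Qed.

End sequence.
End samples.

(** * Means of feature vectors and of their samples *)

Section feature_means.
Context {R : realType} {H : completeNormedModType R}.
Variable ip : {dot H for (@idfun R)}.
Context d {T : measurableType d}.
Variables (X : set T) (phi : T -> H).
Hypothesis mX : measurable X.
Hypothesis Hrkhs : rkhs ip X phi.
Hypothesis Hker : measurable_rkhs_kernel ip X phi.
Hypothesis phi_le1 : forall x, X x -> `|phi x| <= 1.

Let hn : hilbert_norm ip := Hrkhs.1.

Lemma measurable_kernel_section y : X y ->
  measurable_fun X (fun x => ip (phi y) (phi x)).
Proof.
move=> Xy.
have -> : (fun x => ip (phi y) (phi x)) =
  (fun z : T * T => rkhs_kernel ip phi z.1 z.2) \o (fun x => (y, x)) by [].
apply: (measurable_comp (measurableX mX mX)) => //.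
- by move=> _ [a Xa <-].
- by apply: measurable_funTS; apply: measurable_pair1.
Qed.

(* The vectors with a measurable evaluation form a closed subspace containing
   every [phi y]; its orthogonal complement is trivial by [rkhs]. *)
Lemma measurable_feval v : measurable_fun X (feval ip phi v).
Proof.
pose V : set H := [set v | measurable_fun X (feval ip phi v)].
have [||||u _|m Vm mE] := @riesz_closed_subspace _ _ ip hn V (ip v) `|v|.
- rewrite /V/= (_ : feval ip phi 0 = cst 0); first exact: measurable_cst.
  by apply/funext => x; rewrite /feval ip0l.
- move=> a u w Vu Vw; rewrite /V/=.
  rewrite (_ : feval _ _ _ = (fun x => a * feval ip phi u x + feval ip phi w x)).
    by apply: measurable_funD => //; exact: measurable_funM.
  by apply/funext => x; rewrite /feval ipDl ipZl.
- move=> f l Vf fl; apply: (@measurable_fun_cvg _ _ _ _ (fun n => feval ip phi (f n))) => //.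
  move=> x Xx; rewrite /feval ipC.
  under eq_cvg do rewrite ipC.
  by apply: continuous_cvg => //; exact: continuous_ip.
- by move=> a u w _ _; rewrite ipDr ipZr.
- exact: CauchySchwarz_ip.
- rewrite (_ : v = m)//; apply: Hrkhs.2 => x Xx.
  by rewrite /feval mE//; exact: measurable_kernel_section.
Qed.

Lemma measurable_norm_feature : measurable_fun X (fun x => `|phi x|).
Proof.
have -> : (fun x => `|phi x|) = (@Num.sqrt R) \o
    ((fun z : T * T => rkhs_kernel ip phi z.1 z.2) \o (fun x => (x, x))).
  by apply/funext => x /=; rewrite /rkhs_kernel -hn sqrtr_sqr normr_id.
apply: measurableT_comp.
  by apply: continuous_measurable_fun; exact: sqrt_continuous.
apply: (measurable_comp (measurableX mX mX)) => //.
- by move=> _ [a Xa <-].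
- apply: measurable_funTS; exact: (measurable_fun_pair (@measurable_id _ _ setT) (@measurable_id _ _ setT)).
Qed.

Lemma feval_le v x : X x -> `|feval ip phi v x| <= `|v|.
Proof.
move=> Xx; rewrite (le_trans (CauchySchwarz_ip hn _ _))//.
by rewrite ler_piMr// phi_le1.
Qed.

Section mean.
Variables (Q : probability T R) (c : T -> R) (C : R).
Hypothesis mc : measurable_fun X c.
Hypothesis cC : forall x, X x -> `|c x| <= C.

Let mcu u : measurable_fun X (fun x => ip (c x *: phi x) u).
Proof.
rewrite (_ : (fun _ => _) = (fun x => c x * feval ip phi u x)).
  by apply: measurable_funM => //; exact: measurable_feval.
by apply/funext => x; rewrite ipZl ipC.
Qed.

Let cuC u x : X x -> `|ip (c x *: phi x) u| <= C * `|u|.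
Proof.
move=> Xx; rewrite ipZl normrM ler_pM ?cC// ipC; exact: feval_le.
Qed.

Lemma integrable_feature u : Q.-integrable X (fun x => (ip (c x *: phi x) u)%:E).
Proof. exact: (bounded_integrable Q mX (mcu u) (@cuC u)). Qed.

(** Integration against [u] is a bounded functional, represented through Riesz on the whole space;
    hence [mean] does not fall back on its default value 0. *)
Lemma mean_is_mean :
  is_mean ip Q X (fun x => c x *: phi x) (mean ip Q X (fun x => c x *: phi x)).
Proof.
apply: xgetPex.
have [||||u _|m _ mE] := @riesz_closed_subspace _ _ ip hn setT
    (fun u => \int[Q]_(x in X) ip (c x *: phi x) u) `|C| => //.
- move=> a u v _ _; rewrite -RintegralZl ?integrable_feature// -RintegralD//.
  + by apply: eq_Rintegral => x _; rewrite ipDr ipZr.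
  + rewrite (_ : _ \o _ = (fun x => a%:E * (ip (c x *: phi x) u)%:E)%E).
      by apply: integrableZl => //; exact: integrable_feature.
    by apply/funext => x /=; rewrite EFinM.
  + exact: integrable_feature.
- apply: (le_trans (le_normr_Rintegral mX (integrable_feature u))).
  apply: Rintegral_le_cst => //.
  + exact: measurableT_comp.
  + by move=> x Xx; rewrite normr_id (le_trans (cuC _ Xx))// ler_wpM2r// ler_norm.
by exists m => u; split; [exact: integrable_feature | exact: mE].
Qed.

Variable m : H.
Hypothesis m_mean : is_mean ip Q X (fun x => c x *: phi x) m.

(** Test the mean against [m] itself. *)
Lemma mean_norm_le : 0 <= C -> `|m| <= C.
Proof.
move=> C0; have [->|m0] := eqVneq m 0; first by rewrite normr0.
have n0 : 0 < `|m| by rewrite normr_gt0.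
rewrite -(ler_pM2r n0) -expr2 hn (m_mean m).2.
apply: Rintegral_le_cst => //; first by rewrite mulr_ge0.
by move=> x Xx; exact: cuC.
Qed.

Context d' {Omega : measurableType d'} (P : probability Omega R).
Variable x : nat -> {RV P >-> T}.
Hypothesis xX : forall i w, X (x i w).
Hypothesis xQ : forall i A, measurable A -> P (x i @^-1` A) = Q A.
Hypothesis x_indep : forall n (A : nat -> set T), (forall i, measurable (A i)) ->
  P (\bigcap_(i in `I_n) (x i @^-1` A i)) = (\prod_(i < n) P (x i @^-1` A i))%E.

Let f y := c y *: phi y - m.
Let K (z : T * T) := ip (f z.1) (f z.2).

(** Measurability of [K] is read off this formula, whose terms are scalar functions; no
    measurability of [phi] as a map into [H] is invoked. *)
Let KE a b : K (a, b) = c a * c b * rkhs_kernel ip phi a b -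
  c a * feval ip phi m a - c b * feval ip phi m b + ip m m.
Proof.
rewrite /K /f /= !(ipBl, ipBr, ipZl, ipZr) /feval /rkhs_kernel (ipC ip (phi a) m).
ring.
Qed.

Let measurable_K : measurable_fun (X `*` X) K.
Proof.
have m1 (g : T -> R) : measurable_fun X g -> measurable_fun (X `*` X) (fun z : T * T => g z.1).
  move=> mg; apply: (measurable_comp mX) => //; first by move=> _ [[a b] [Xa Xb] <-].
  exact: measurable_funTS.
have m2 (g : T -> R) : measurable_fun X g -> measurable_fun (X `*` X) (fun z : T * T => g z.2).
  move=> mg; apply: (measurable_comp mX) => //; first by move=> _ [[a b] [Xa Xb] <-].
  exact: measurable_funTS.
have mcm : measurable_fun X (fun a => c a * feval ip phi m a).
  by apply: measurable_funM => //; exact: measurable_feval.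
rewrite (_ : K = fun z => c z.1 * c z.2 * rkhs_kernel ip phi z.1 z.2 -
  c z.1 * feval ip phi m z.1 - c z.2 * feval ip phi m z.2 + ip m m); last first.
  by apply/funext => -[a b]; rewrite KE.
apply: measurable_funD => //.
apply: measurable_funB; last exact: (m2 _ mcm).
apply: measurable_funB; last exact: (m1 _ mcm).
apply: measurable_funM => //.
by apply: measurable_funM; [exact: m1 | exact: m2].
Qed.

(** The squared deviation is [n^-2] times the double sum of the centred kernel [K], which is bounded
    by [4 C^2]. Only the diagonal survives in the mean, which is therefore at most [4 C^2 / n], and
    Markov's inequality concludes. *)
Lemma empirical_mean_chebyshev n r : (0 < n)%N -> 0 <= C -> 0 < r ->
  (mu_ext P [set w | (r < `|n%:R^-1 *: \sum_(i < n) c (x i w) *: phi (x i w) - m|)%R]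
   <= (4 * C ^+ 2 / (n%:R * r ^+ 2))%:E)%E.
Proof.
move=> n0 C0 r0.
have nR : n%:R != 0 :> R by rewrite pnatr_eq0 -lt0n.
have f2C a : X a -> `|f a| <= 2 * C.
  move=> Xa; rewrite (le_trans (ler_normB _ _))//.
  have : `|c a *: phi a| <= C.
    by rewrite normrZ -[leRHS]mulr1 ler_pM ?cC ?phi_le1.
  have := mean_norm_le C0; lra.
have KC a b : X a -> X b -> `|K (a, b)| <= 4 * C ^+ 2.
  move=> Xa Xb; rewrite (le_trans (CauchySchwarz_ip hn _ _))//.
  rewrite (_ : 4 * C ^+ 2 = (2 * C) * (2 * C)); last by ring.
  by rewrite ler_pM ?f2C.
have K0 b : X b -> \int[Q]_(a in X) K (a, b) = 0.
  move=> Xb.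
  transitivity (\int[Q]_(a in X) (ip (c a *: phi a) (f b)) - \int[Q]_(a in X) (ip m (f b))).
    rewrite -RintegralB//.
    - by apply: eq_Rintegral => a _; rewrite /K /f/= [LHS]ipBl.
    - exact: integrable_feature.
    - by apply: (bounded_integrable Q (C := `|ip m (f b)|)) => //; exact: measurable_cst.
  rewrite -(m_mean (f b)).2 Rintegral_cst//.
  (* The samples take their values in [X] and follow [Q], so [X] has full mass. *)
  suff -> : fine (Q X) = 1 by rewrite mulr1 subrr.
  rewrite -(xQ 0%N mX) (_ : x 0%N @^-1` X = setT) ?probability_setT//.
  by apply/seteqP; split => // w _ /=; exact: xX.
pose Y w := n%:R^-1 ^+ 2 * (\sum_(i < n) \sum_(j < n) K (x i w, x j w)).
have YE w : Y w = `|n%:R^-1 *: \sum_(i < n) c (x i w) *: phi (x i w) - m| ^+ 2.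
  have -> : n%:R^-1 *: \sum_(i < n) c (x i w) *: phi (x i w) - m =
      n%:R^-1 *: \sum_(i < n) f (x i w).
    rewrite /f sumrB sumr_const card_ord scalerBr; congr (_ - _).
    by rewrite -[m *+ n]scaler_nat scalerA mulVf// scale1r.
  rewrite hn ipZl ipZr ip_suml mulrA -expr2 /Y; congr (_ * _).
  by apply: eq_bigr => i _; rewrite ip_sumr.
have mKij i j : measurable_fun setT (fun w => K (x i w, x j w)).
  exact: (measurable_sample_pair mX (xX i) (xX j) measurable_K).
have sum_le (F : 'I_n -> R) B : (forall i, F i <= B) -> \sum_(i < n) F i <= n%:R * B.
  move=> FB; apply: (@le_trans _ _ (\sum_(i < n) B)); first exact: ler_sum.
  by rewrite sumr_const card_ord mulr_natl.
have iS : P.-integrable setT (EFin \o fun w => \sum_(i < n) \sum_(j < n) K (x i w, x j w)).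
  apply: (bounded_integrable P (C := n%:R * (n%:R * (4 * C ^+ 2)))) => //.
    apply: measurable_sum => i; exact: measurable_sum.
  move=> w _; apply: (le_trans (ler_norm_sum _ _ _)); apply: (sum_le _) => i.
  apply: (le_trans (ler_norm_sum _ _ _)); apply: (sum_le _) => j.
  exact: KC.
apply: (@le_trans _ _ (mu_ext P [set w | (r ^+ 2 < Y w)%R])).
  apply: le_mu_ext => w /= h; rewrite YE.
  by rewrite ltrXn2r// ?nnegrE ?ltW.
rewrite (_ : 4 * C ^+ 2 / (n%:R * r ^+ 2) = (4 * C ^+ 2 / n%:R) / r ^+ 2); last first.
  by field; rewrite nR gt_eqF.
apply: markov_outer.
- by rewrite exprn_gt0.
- by move=> w; rewrite YE sqr_ge0.
- apply: measurable_funM => //; apply: measurable_sum => i; exact: measurable_sum.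
- rewrite (_ : _ \o _ = (fun w => (n%:R^-1 ^+ 2)%:E *
    (\sum_(i < n) \sum_(j < n) K (x i w, x j w))%:E)%E).
    exact: integrableZl.
  by apply/funext => w /=; rewrite EFinM.
- rewrite RintegralZl//.
  have := @double_sum_mean_le _ _ _ _ _ P Q X mX x xX xQ x_indep K (4 * C ^+ 2) n.
  move=> /(_ measurable_K KC K0); rewrite mulr_ge0 ?sqr_ge0// => /(_ isT) h.
  apply: (@le_trans _ _ (n%:R^-1 ^+ 2 * (n%:R * (4 * C ^+ 2)))).
    by rewrite ler_wpM2l// sqr_ge0.
  by rewrite le_eqVlt; apply/orP; left; apply/eqP; field.
Qed.

End mean.
End feature_means.

(** * The basic inequality *)

Section basic_inequality.
Context {R : realType} {H : completeNormedModType R}.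
Variable ip : {dot H for (@idfun R)}.
Hypothesis hn : hilbert_norm ip.
Context d {T : measurableType d}.
Variables (phi : T -> H) (vs u : H).

Let s x : R := ip vs (phi x).
Let y x : R := ip u (phi x).

(** For [0 <= t] this is equivalent to [<v, phi x>] lying in the open interval for all [v] within
    [t] of [vs], by Cauchy-Schwarz and its equality case. It turns hypothesis (2) into a condition
    on each sample point. *)
Definition interior_point (t : R) (x : T) :=
  t * `|phi x| < ip vs (phi x) < pi / 2 - t * `|phi x|.

(* Coefficients of [phi x] in the second-order model, around [vs] in the
   direction [u], of the gradient of [- sin] and of [- cos]. *)
Definition model_plus x := y x * sin (s x) - cos (s x).
Definition model_minus x := y x * cos (s x) + sin (s x).

Lemma interior_point_gt0 (t : R) x : 0 <= t -> interior_point t x -> 0 < s x < pi / 2.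
Proof.
move=> t0 /andP[h1 h2]; have : 0 <= t * `|phi x| by rewrite mulr_ge0.
by move: h1 h2; rewrite -/(s x) => h1 h2 h3; apply/andP; split; lra.
Qed.

Lemma interior_shift (t : R) x : `|u| <= t / 2 -> interior_point t x ->
  [/\ `|y x| <= s x / 2, `|y x| <= (pi / 2 - s x) / 2 & 0 <= ip (vs + u) (phi x) <= pi / 2].
Proof.
move=> ut /andP[]; rewrite -/(s x) => h1 h2.
have yu : `|y x| <= t / 2 * `|phi x|.
  by apply: (le_trans (CauchySchwarz_ip hn _ _)); rewrite ler_wpM2r.
have E : t / 2 * `|phi x| = (t * `|phi x|) / 2 by ring.
rewrite E in yu.
have yp : `|y x| <= s x / 2 by lra.
have ym : `|y x| <= (pi / 2 - s x) / 2 by lra.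
split => //; rewrite ipDl -/(s x) -/(y x).
have t0 : 0 <= t by move: (normr_ge0 u) ut; lra.
have := interior_point_gt0 t0; move=> /(_ x); rewrite /interior_point -/(s x) h1 h2 => /(_ isT) s0.
by move: yp ym; rewrite !ler_norml; lra.
Qed.

Lemma sin_model (t : R) x b : 0 <= t -> `|u| <= t / 2 -> interior_point t x ->
  0 <= ip b (phi x) <= pi / 2 ->
  model_plus x * ip (b - (vs + u)) (phi x) - y x ^+ 4 / sin (s x) <=
  sin (ip (vs + u) (phi x)) - sin (ip b (phi x)).
Proof.
move=> t0 ut ix bx; have [y1 _ vx] := interior_shift ut ix.
have := sin_expansion (interior_point_gt0 t0 ix) y1.
by move: vx; rewrite ipBl !ipDl -/(s x) -/(y x) => vx /(_ _ vx bx).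
Qed.

(** The reflection [z -> pi/2 - z] exchanges sine and cosine and changes the sign of the shift,
    reducing this to [sin_expansion]. *)
Lemma cos_model (t : R) x b : 0 <= t -> `|u| <= t / 2 -> interior_point t x ->
  0 <= ip b (phi x) <= pi / 2 ->
  model_minus x * ip (b - (vs + u)) (phi x) - y x ^+ 4 / cos (s x) <=
  cos (ip (vs + u) (phi x)) - cos (ip b (phi x)).
Proof.
move=> t0 ut ix bx; have [_ y1 vx] := interior_shift ut ix.
have s0 := interior_point_gt0 t0 ix.
have flip (z : R) : sin (pi / 2 - z) = cos z.
  by rewrite -opprB sinN sinBpihalf opprK.
have flop (z : R) : cos (pi / 2 - z) = sin z.
  by rewrite -opprB cosN cosBpihalf.
have h1 : 0 < pi / 2 - s x < pi / 2 by lra.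
have h2 : `|- y x| <= (pi / 2 - s x) / 2 by rewrite normrN.
move: vx; rewrite ipBl ipDl -/(s x) -/(y x) => vx.
have h3 : 0 <= pi / 2 - s x + - y x <= pi / 2 by lra.
have h4 : 0 <= pi / 2 - ip b (phi x) <= pi / 2 by lra.
have := sin_expansion h1 h2 h3 h4.
rewrite (_ : pi / 2 - s x + - y x = pi / 2 - (s x + y x)); last by ring.
rewrite !flip flop /model_minus (_ : (- y x) ^+ 4 = y x ^+ 4); last by ring.
apply: le_trans; rewrite le_eqVlt; apply/orP; left; apply/eqP; ring.
Qed.

Lemma average_le n (F G : 'I_n -> R) : (forall i, F i <= G i) ->
  n%:R^-1 * \sum_(i < n) F i <= n%:R^-1 * \sum_(i < n) G i.
Proof. by move=> FG; rewrite ler_wpM2l// ler_sum. Qed.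

Lemma average_ip n (c : nat -> R) (x : nat -> T) h :
  ip h (n%:R^-1 *: \sum_(i < n) c i *: phi (x i)) =
  n%:R^-1 * \sum_(i < n) c i * ip h (phi (x i)).
Proof.
by rewrite ipZr ip_sumr; congr (_ * _); apply: eq_bigr => i _; rewrite ipZr.
Qed.

Variables (np nm : nat) (xp xm : nat -> T).

(** Optimality is tested against [vs + u], which the margin makes feasible. The penalty expands
    exactly around that point and supplies the quadratic term. The losses are compared through the
    sample-wise models, whose averages [N1] and [N2] are exchanged for [m1] and [m2] at cost [r]
    each. *)
Lemma estimator_basic_inequality (t lam r A q : R) (m1 m2 vhat : H)
    (psip psim : T -> R) : 0 <= t -> `|u| <= t / 2 ->
  on_sample np nm xp xm (interior_point t) ->
  (forall i, (i < np)%N -> y (xp i) ^+ 4 / sin (s (xp i)) <= psip (xp i)) ->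
  (forall i, (i < nm)%N -> y (xm i) ^+ 4 / cos (s (xm i)) <= psim (xm i)) ->
  estimator ip phi np nm xp xm lam vhat ->
  `|np%:R^-1 *: \sum_(i < np) model_plus (xp i) *: phi (xp i) - m1| <= r ->
  `|nm%:R^-1 *: \sum_(i < nm) model_minus (xm i) *: phi (xm i) - m2| <= r ->
  `|m1 + m2 + lam *: (vs + u)| <= A ->
  np%:R^-1 * (\sum_(i < np) psip (xp i)) <= q ->
  nm%:R^-1 * (\sum_(i < nm) psim (xm i)) <= q ->
  lam / 2 * `|vhat - (vs + u)| ^+ 2 <= (2 * r + A) * `|vhat - (vs + u)| + 2 * q.
Proof.
move=> t0 ut [ip_ im_] psipP psimP [[fp fm] opt] N1r N2r mA qp qm.
have feas : feasible ip phi np nm xp xm (vs + u).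
  split => i hi; first by have [] := interior_shift ut (ip_ i hi).
  by have [] := interior_shift ut (im_ i hi).
have := opt _ feas.
set h := vhat - (vs + u).
have -> : `|vhat| ^+ 2 = `|vs + u| ^+ 2 + 2 * ip h (vs + u) + `|h| ^+ 2.
  rewrite (_ : vhat = vs + u + h); last by rewrite /h addrC subrK.
  by rewrite !hn (ipDr ip _ (vs + u)) !(ipDl ip _ (vs + u)) (ipC ip _ h); ring.
set N1 := _ *: _ in N1r; set N2 := _ *: _ in N2r.
have L1 : ip h N1 - np%:R^-1 * (\sum_(i < np) psip (xp i)) <=
    np%:R^-1 * (\sum_(i < np) sin (feval ip phi (vs + u) (xp i))) -
    np%:R^-1 * (\sum_(i < np) sin (feval ip phi vhat (xp i))).
  rewrite (average_ip _ (fun i => model_plus (xp i))) -!mulrBr -!sumrB.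
  apply: average_le => i; apply: le_trans (sin_model t0 ut (ip_ _ _) (fp _ _)) => //.
  by rewrite lerB// psipP.
have L2 : ip h N2 - nm%:R^-1 * (\sum_(i < nm) psim (xm i)) <=
    nm%:R^-1 * (\sum_(i < nm) cos (feval ip phi (vs + u) (xm i))) -
    nm%:R^-1 * (\sum_(i < nm) cos (feval ip phi vhat (xm i))).
  rewrite (average_ip _ (fun i => model_minus (xm i))) -!mulrBr -!sumrB.
  apply: average_le => i; apply: le_trans (cos_model t0 ut (im_ _ _) (fm _ _)) => //.
  by rewrite lerB// psimP.
have L3 : - ((2 * r + A) * `|h|) <= ip h N1 + ip h N2 + lam * ip h (vs + u).
  have -> : ip h N1 + ip h N2 + lam * ip h (vs + u) =
      ip h ((N1 - m1) + (N2 - m2) + (m1 + m2 + lam *: (vs + u))).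
    rewrite !(ipDr, ipNr, ipZr); ring.
  have := CauchySchwarz_ip hn h ((N1 - m1) + (N2 - m2) + (m1 + m2 + lam *: (vs + u))).
  set z := ip h _ => hz.
  have : `|z| <= (2 * r + A) * `|h|.
    apply: (le_trans hz); rewrite mulrC ler_wpM2r//.
    apply: (le_trans (ler_normD _ _)); apply: lerD => //.
    by apply: (le_trans (ler_normD _ _)); lra.
  by rewrite ler_norml => /andP[].
rewrite /loss; move: L1 L2 L3 qp qm.
move: (_ * \sum_(i < np) psip _) (_ * \sum_(i < nm) psim _) => a1 a2.
move: (_ * \sum_(i < np) sin (feval ip phi (vs + u) _)) => a3.
move: (_ * \sum_(i < np) sin (feval ip phi vhat _)) => a4.
move: (_ * \sum_(i < nm) cos (feval ip phi (vs + u) _)) => a5.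
move: (_ * \sum_(i < nm) cos (feval ip phi vhat _)) => a6.
move: (ip h N1) (ip h N2) (ip h (vs + u)) ((2 * r + A) * `|h|) => b1 b2 b3 b4.
move: (`|vs + u| ^+ 2) (`|h| ^+ 2) => b5 b6 *.
lra.
Qed.

End basic_inequality.

(** * Mass near the boundary of the constraint *)

Section boundary_tail.
Context {R : realType}.

(** Induction, from [(1 - p)(1 + (n+1) p) <= 1 + n p]. It turns a lower bound on the probability of
    missing a set in [n] draws into an upper bound on the mass of the set. *)
Lemma one_sub_expn_le (p : R) n : 0 <= p <= 1 -> (1 - p) ^+ n * (1 + n%:R * p) <= 1.
Proof.
move=> /andP[p0 p1]; elim: n => [|n ih]; first by rewrite expr0 mul0r addr0 mulr1.
apply: le_trans ih; rewrite exprSr -mulrA ler_wpM2l ?exprn_ge0 ?subr_ge0//.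
rewrite -natr1; have : 0 <= n%:R * p * p by rewrite !mulr_ge0.
nra.
Qed.

(** Telescoping, as [1/m^2 <= 2/m - 2/(m+1)] for [1 <= m]. *)
Lemma sum_inv_sqr_le (a b : nat) : (0 < a)%N -> (a <= b)%N ->
  \sum_(a <= m < b) (m%:R ^+ 2)^-1 <= 2 / a%:R - 2 / b%:R :> R.
Proof.
move=> a0; elim: b => [|b ih].
  by rewrite leqNgt a0.
rewrite leq_eqVlt => /predU1P[<-|]; first by rewrite big_geq// subrr.
rewrite ltnS => ab; rewrite big_nat_recr//=.
apply: (le_trans (lerD (ih ab) (lexx _))).
have b0 : 0 < b%:R :> R by rewrite ltr0n (leq_trans a0).
have b1 : 1 <= b%:R :> R by rewrite ler1n (leq_trans a0).
rewrite -[b.+1%:R]natr1; move: b%:R b0 b1 => x x0 x1.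
rewrite -subr_ge0.
rewrite [X in 0 <= X](_ : _ = (x - 1) / (x ^+ 2 * (x + 1))); last first.
  field; rewrite pnatr_eq0 -lt0n a0 /=; apply/andP; split; lra.
by rewrite divr_ge0 ?subr_ge0// mulr_ge0 ?sqr_ge0// addr_ge0 ?ltW.
Qed.

Context d d' {T : measurableType d} {Omega : measurableType d'}.
Variables (P : probability Omega R) (Q : probability T R).
Variable x : nat -> {RV P >-> T}.
Hypothesis xQ : forall i A, measurable A -> P (x i @^-1` A) = Q A.
Hypothesis x_indep : forall n (A : nat -> set T), (forall i, measurable (A i)) ->
  P (\bigcap_(i in `I_n) (x i @^-1` A i)) = (\prod_(i < n) P (x i @^-1` A i))%E.

(** The event that all [n] draws miss [A] is measurable, contains [E], and has probability
    [(1 - p)^n], where [p] is the mass of [A]. This is at least 1/2, so [1 + n p <= 2].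
    Measurability of [E] is bypassed by the outer measure. *)
Lemma avoided_set_prob_le n (A : set T) (E : set Omega) : (0 < n)%N ->
  measurable A -> (mu_ext P (~` E) <= (2^-1)%:E)%E ->
  (forall w, E w -> forall i, (i < n)%N -> ~ A (x i w)) ->
  fine (Q A) <= n%:R^-1.
Proof.
move=> n0 mA PE EA.
have fQ B : measurable B -> Q B = (fine (Q B))%:E.
  by move=> mB; rewrite fineK// fin_num_measure.
set B := \bigcap_(i in `I_n) (x i @^-1` (~` A)).
have mCA : measurable (~` A) by exact: measurableC.
have mB : measurable B.
  apply: bigcap_measurable => [|i _]; first by exists 0%N.
  by rewrite -[X in measurable X]setTI; exact: measurable_funPT.
have PB : P B = ((1 - fine (Q A)) ^+ n)%:E.
  rewrite (x_indep n (fun=> mCA)) (eq_bigr (fun=> (1 - fine (Q A))%:E)) => [|i _].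
    by rewrite prodEFin big_const_ord iter_mulr_1.
  by rewrite xQ// probability_setC// [in LHS]fQ.
have : (P (~` B) <= (2^-1)%:E)%E.
  rewrite -measurable_mu_extE; last exact: measurableC.
  apply: le_trans PE; apply: le_mu_ext => w + Ew; apply => i /= ni.
  exact: EA.
rewrite probability_setC// PB lee_fin => h.
have Q01 : 0 <= fine (Q A) <= 1.
  by rewrite fine_ge0//= -lee_fin -fQ// probability_le1.
have := one_sub_expn_le n Q01.
set p := fine (Q A); set z := (1 - p) ^+ n in h * => k.
have n1 : 0 < n%:R :> R by rewrite ltr0n.
rewrite -div1r ler_pdivlMr// mulrC.
have : 0 <= n%:R * p by rewrite mulr_ge0//; case/andP: Q01.
move: h k; rewrite -/p; move: (n%:R * p) => y; nra.
Qed.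

End boundary_tail.

(** * Integrability of the inverse distance to the boundary *)

Section boundary_weight.
Context {R : realType} {H : completeNormedModType R}.
Variable ip : {dot H for (@idfun R)}.
Context d {T : measurableType d}.
Variables (X : set T) (phi : T -> H).
Hypothesis mX : measurable X.
Hypothesis Hrkhs : rkhs ip X phi.
Hypothesis Hker : measurable_rkhs_kernel ip X phi.
Variable vs : H.

Definition boundary (t : R) : set T := X `&` ~` interior_point ip phi vs t.

Lemma measurable_boundary t : measurable (boundary t).
Proof.
have mphi := measurable_norm_feature mX Hrkhs Hker.
have ms := measurable_feval mX Hrkhs Hker vs.
have mt : measurable_fun X (fun x => t * `|phi x|) by exact: measurable_funM.
have mle (f : T -> R) : measurable_fun X f -> measurable (X `&` [set x | f x <= 0]).
  move=> mf; have := mf mX _ (measurable_itv `]-oo, 0]).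
  congr (measurable (_ `&` _)); apply/seteqP; split => z /=; by rewrite in_itv.
rewrite (_ : boundary t = (X `&` [set x | feval ip phi vs x - t * `|phi x| <= 0]) `|`
    (X `&` [set x | pi / 2 - t * `|phi x| - feval ip phi vs x <= 0])).
  apply: measurableU; apply: mle; first exact: measurable_funB.
  apply: measurable_funB => //; apply: measurable_funB => //.
rewrite -setIUr /boundary; congr (_ `&` _).
apply/seteqP; split => z /=; rewrite /interior_point /feval.
  move=> /negP; rewrite negb_and -!leNgt => /orP[h|h]; [left|right]; lra.
by move=> [h|h] /andP[]; lra.
Qed.

Lemma interior_pointS t t' x : t <= t' -> interior_point ip phi vs t' x ->
  interior_point ip phi vs t x.
Proof.
move=> tt /andP[h1 h2]; have : t * `|phi x| <= t' * `|phi x| by rewrite ler_wpM2r.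
by move=> h; apply/andP; split; lra.
Qed.

Variables (K beta : R).
Hypothesis K0 : 0 < K.
Hypothesis beta01 : 0 < beta <= 1.

(** The lower bound [K / n^(beta/4)] on the radius in hypothesis (2), at sample size [n = m^4]. *)
Let level (m : nat) := K / m%:R `^ beta.

Lemma level_nonincreasing m n : (0 < m)%N -> (m <= n)%N -> level n <= level m.
Proof.
move=> m0 mn; rewrite ler_pM2l// lef_pV2 ?posrE ?powR_gt0 ?ltr0n// ?(leq_trans m0)//.
by apply: ge0_ler_powR; rewrite ?nnegrE ?ler_nat//; case/andP: beta01 => /ltW.
Qed.

Lemma level_ge m : (0 < m)%N -> K / m%:R <= level m.
Proof.
move=> m0; rewrite ler_pM2l// lef_pV2 ?posrE ?powR_gt0 ?ltr0n//.
by apply: ler1_powR; [rewrite ler1n | case/andP: beta01].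
Qed.

(* Up to the factor [K], an upper bound for [|phi x|] divided by the distance
   of [<vs, phi x>] to [{0, pi/2}]. *)
Definition boundary_weight (a n : nat) (x : T) : R :=
  a%:R + \sum_(a <= m < n) \1_(boundary (level m)) x.

(** Being interior at level [m] puts the distance to the boundary above [K |phi x| / m]. The weight
    is at least the first such [m] from [a] on, since each earlier level contributes 1 to the
    sum. *)
Lemma boundary_weightP a n x : (0 < a)%N -> (a <= n)%N -> X x ->
  interior_point ip phi vs (level n) x ->
  K * `|phi x| <= ip vs (phi x) * boundary_weight a n x /\
  K * `|phi x| <= (pi / 2 - ip vs (phi x)) * boundary_weight a n x.
Proof.
move=> a0 + Xx.
have step m : (0 < m)%N -> interior_point ip phi vs (level m) x ->
    K * `|phi x| <= ip vs (phi x) * m%:R /\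
    K * `|phi x| <= (pi / 2 - ip vs (phi x)) * m%:R.
  move=> m0 ix; have mR : 0 < m%:R :> R by rewrite ltr0n.
  have /andP[h1 h2] := interior_pointS (level_ge m0) ix.
  have E : K * `|phi x| = (K / m%:R * `|phi x|) * m%:R by field; rewrite gt_eqF.
  by rewrite E !ler_pM2r//; split; lra.
elim: n => [|n ih]; first by rewrite leqNgt a0.
rewrite leq_eqVlt => /predU1P[<-|].
  by rewrite /boundary_weight big_geq// addr0; exact: step.
rewrite ltnS => an ix.
have [/ih|nin] := pselect (interior_point ip phi vs (level n) x).
  move=> /(_ an)[h1 h2].
  have le_w : boundary_weight a n x <= boundary_weight a n.+1 x.
    by rewrite /boundary_weight big_nat_recr//= addrA lerDl indicE.
  have lv0 : 0 <= level n.+1 by rewrite divr_ge0 ?powR_ge0 ?ltW.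
  have /andP[s0 s1] := interior_point_gt0 lv0 ix.
  split; [apply: (le_trans h1)|apply: (le_trans h2)]; rewrite ler_wpM2l//; lra.
(* Levels decrease with [m], so failing at level [n] means failing at every earlier one: all
   indicators are 1 and the weight is exactly [n + 1]. *)
rewrite /boundary_weight (eq_big_nat _ _ (F2 := fun=> 1)) => [|m /andP[am]]; last first.
  rewrite ltnS => mn; rewrite indicE mem_set//; split => // im; apply: nin.
  by apply: interior_pointS im; apply: level_nonincreasing => //; exact: leq_trans am.
rewrite sumr_const_nat -natrD subnKC ?(leqW an)//.
exact: step.
Qed.

Lemma boundary_weight_bound a n x : 0 <= boundary_weight a n x <= a%:R + n%:R.
Proof.
rewrite /boundary_weight addr_ge0 ?sumr_ge0//= lerD2l.
apply: (@le_trans _ _ (\sum_(a <= m < n) 1)).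
  by apply: ler_sum => m _; rewrite indicE lern1 leq_b1.
by rewrite sumr_const_nat ler_nat leq_subr.
Qed.

Lemma measurable_boundary_weight a n : measurable_fun X (boundary_weight a n).
Proof.
apply: measurable_funD => //; apply: measurable_sum => m.
by apply: measurable_funTS; apply: measurable_indic; exact: measurable_boundary.
Qed.

(** The mean is [a] plus the sum of the masses of the layers, and the tail of the inverse squares
    from [a] is at most [2 / a <= 2], uniformly in [n]. *)
Lemma boundary_weight_mean_le (Q : probability T R) a n : (0 < a)%N -> (a <= n)%N ->
  (forall m, (a <= m)%N -> fine (Q (boundary (level m))) <= (m%:R ^+ 2)^-1) ->
  \int[Q]_(x in X) boundary_weight a n x <= a%:R + 2.
Proof.
move=> a0 an tail.
have mi m : measurable_fun X (\1_(boundary (level m)) : T -> R).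
  by apply: measurable_funTS; apply: measurable_indic; exact: measurable_boundary.
have ii m : Q.-integrable X (EFin \o (\1_(boundary (level m)) : T -> R)).
  apply: (bounded_integrable Q (C := 1)) => // x _.
  by rewrite indicE ger0_norm// lern1 leq_b1.
rewrite /boundary_weight RintegralD//.
- apply: lerD.
    by apply: Rintegral_le_cst => // x _; rewrite ger0_norm.
  rewrite Rintegral_sum//.
  apply: (@le_trans _ _ (\sum_(a <= m < n) (m%:R ^+ 2)^-1)).
    rewrite big_nat [leRHS]big_nat; apply: ler_sum => m /andP[am _].
    apply: le_trans (tail m am); rewrite /Rintegral integral_indic//.
      by rewrite (_ : _ `&` X = boundary (level m))// setIidl// => z [].
    exact: measurable_boundary.
  apply: (le_trans (sum_inv_sqr_le a0 an)).
  have : 2 / a%:R <= 2 :> R.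
    by rewrite ler_pdivrMr ?ltr0n// ler_peMr// ler1n.
  have : 0 <= 2 / n%:R :> R by rewrite divr_ge0.
  lra.
- by apply: (bounded_integrable Q (C := a%:R)) => // x _; rewrite ger0_norm.
- rewrite (_ : _ \o _ = fun x => (\sum_(a <= m < n) (\1_(boundary (level m)) x)%:E)%E).
    by apply: integrable_sum => // m _; exact: ii.
  by apply/funext => z /=; rewrite sumEFin.
Qed.

End boundary_weight.

(** * Rate of convergence *)

Section population_model.
Context {R : realType} {H : completeNormedModType R}.
Variable ip : {dot H for (@idfun R)}.

Lemma is_mean_unique d (T : measurableType d) (Q : {measure set T -> \bar R})
    (X : set T) (f : T -> H) (m m' : H) : is_mean ip Q X f m -> is_mean ip Q X f m' -> m = m'.
Proof.
move=> fm fm'; apply/eqP; rewrite -subr_eq0; apply/negPn/negP => mm.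
have : 0 < ip (m - m') (m - m') by exact: neq0_dnorm_gt0.
by rewrite (ipBl ip _ m) (fm (m - m')).2 (fm' (m - m')).2 subrr ltxx.
Qed.

Lemma is_meanD d (T : measurableType d) (Q : {measure set T -> \bar R})
    (X : set T) (f g : T -> H) (m m' : H) : measurable X ->
  is_mean ip Q X f m -> is_mean ip Q X g m' -> is_mean ip Q X (fun x => f x + g x) (m + m').
Proof.
move=> mX fm gm u; have [fi fE] := fm u; have [gi gE] := gm u; split.
  rewrite (_ : (fun _ => _) = (fun x => (ip (f x) u)%:E + (ip (g x) u)%:E)%E).
    exact: integrableD.
  by apply/funext => x; rewrite ipDl.
rewrite ipDl fE gE -RintegralD//; apply: eq_Rintegral => x _.
by rewrite ipDl.
Qed.

Lemma is_meanN d (T : measurableType d) (Q : {measure set T -> \bar R})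
    (X : set T) (f : T -> H) (m : H) : measurable X ->
  is_mean ip Q X f m -> is_mean ip Q X (fun x => - f x) (- m).
Proof.
move=> mX fm u; have [fi fE] := fm u; split.
  rewrite (_ : (fun _ => _) = (fun x => (- 1)%:E * (ip (f x) u)%:E)%E).
    exact: integrableZl.
  by apply/funext => x; rewrite ipNl -EFinM mulN1r.
rewrite ipNl fE -mulN1r -RintegralZl//; apply: eq_Rintegral => x _.
by rewrite ipNl mulN1r.
Qed.

Context d {T : measurableType d}.
Variables (X : set T) (phi : T -> H).
Hypothesis mX : measurable X.
Hypothesis Hrkhs : rkhs ip X phi.
Hypothesis Hker : measurable_rkhs_kernel ip X phi.
Hypothesis phi_le1 : forall x, X x -> `|phi x| <= 1.
Variable vs u : H.

Let s x : R := ip vs (phi x).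
Let y x : R := ip u (phi x).

Lemma measurable_sin_feval : measurable_fun X (fun x => sin (s x)).
Proof.
apply: (measurableT_comp (f := @sin R)); last exact: measurable_feval.
by apply: continuous_measurable_fun; exact: continuous_sin.
Qed.

Lemma measurable_cos_feval : measurable_fun X (fun x => cos (s x)).
Proof.
apply: (measurableT_comp (f := @cos R)); last exact: measurable_feval.
by apply: continuous_measurable_fun; exact: continuous_cos.
Qed.

Let my : measurable_fun X y := measurable_feval mX Hrkhs Hker u.

Let yu x : X x -> `|y x| <= `|u|.
Proof. exact: feval_le. Qed.

Lemma measurable_model_plus : measurable_fun X (model_plus ip phi vs u).
Proof.
apply: measurable_funB; last exact: measurable_cos_feval.
by apply: measurable_funM => //; exact: measurable_sin_feval.
Qed.

Lemma measurable_model_minus : measurable_fun X (model_minus ip phi vs u).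
Proof.
apply: measurable_funD; last exact: measurable_sin_feval.
by apply: measurable_funM => //; exact: measurable_cos_feval.
Qed.

Let ysin_le x : X x -> `|y x * sin (s x)| <= `|u|.
Proof. by move=> Xx; rewrite normrM -[leRHS]mulr1 ler_pM ?yu// sin_max. Qed.

Let ycos_le x : X x -> `|y x * cos (s x)| <= `|u|.
Proof. by move=> Xx; rewrite normrM -[leRHS]mulr1 ler_pM ?yu// cos_max. Qed.

Lemma model_plus_le x : X x -> `|model_plus ip phi vs u x| <= `|u| + 1.
Proof.
move=> Xx; rewrite (le_trans (ler_normB _ _))// lerD ?cos_max//.
exact: ysin_le.
Qed.

Lemma model_minus_le x : X x -> `|model_minus ip phi vs u x| <= `|u| + 1.
Proof.
move=> Xx; rewrite (le_trans (ler_normD _ _))// lerD ?sin_max//.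
exact: ycos_le.
Qed.

Variables Pp Pm : probability T R.

Let sig_plus := mean ip Pp X (fun x => (y x * sin (s x)) *: phi x).
Let sig_minus := mean ip Pm X (fun x => (y x * cos (s x)) *: phi x).

Lemma SigmaE : Sigma ip X phi Pp Pm vs u = sig_plus + sig_minus.
Proof.
by rewrite /Sigma; congr (_ + _); congr mean; apply/funext => x;
  rewrite /tensor scalerA mulrC.
Qed.

Let sig_plus_mean : is_mean ip Pp X (fun x => (y x * sin (s x)) *: phi x) sig_plus.
Proof.
apply: (mean_is_mean mX Hrkhs Hker phi_le1 _ _ ysin_le).
by apply: measurable_funM => //; exact: measurable_sin_feval.
Qed.

Let sig_minus_mean : is_mean ip Pm X (fun x => (y x * cos (s x)) *: phi x) sig_minus.
Proof.
apply: (mean_is_mean mX Hrkhs Hker phi_le1 _ _ ycos_le).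
by apply: measurable_funM => //; exact: measurable_cos_feval.
Qed.

(** The part of the models that is linear in [u] averages to [Sigma u]; the constant part averages
    to the population gradient at [vs], which vanishes. *)
Lemma model_mean_sum : mean_grad ip X phi Pp Pm vs = 0 ->
  mean ip Pp X (fun x => model_plus ip phi vs u x *: phi x) +
  mean ip Pm X (fun x => model_minus ip phi vs u x *: phi x) = Sigma ip X phi Pp Pm vs u.
Proof.
rewrite /mean_grad => grad0.
have cos_mean := mean_is_mean mX Hrkhs Hker phi_le1 Pp measurable_cos_feval (fun x _ => cos_max (s x)).
have sin_mean := mean_is_mean mX Hrkhs Hker phi_le1 Pm measurable_sin_feval (fun x _ => sin_max (s x)).
set gp := mean _ _ _ _ in cos_mean; set gm := mean _ _ _ _ in sin_mean.
have -> : mean ip Pp X (fun x => model_plus ip phi vs u x *: phi x) = sig_plus - gp.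
  apply: is_mean_unique (mean_is_mean mX Hrkhs Hker phi_le1 Pp measurable_model_plus model_plus_le) _.
  have := is_meanD mX sig_plus_mean (is_meanN mX cos_mean).
  by congr is_mean; apply/funext => x; rewrite -scalerBl.
have -> : mean ip Pm X (fun x => model_minus ip phi vs u x *: phi x) = sig_minus + gm.
  apply: is_mean_unique (mean_is_mean mX Hrkhs Hker phi_le1 Pm measurable_model_minus model_minus_le) _.
  have := is_meanD mX sig_minus_mean sin_mean.
  by congr is_mean; apply/funext => x; rewrite -scalerDl.
rewrite SigmaE addrACA (_ : - gp + gm = 0) ?addr0//.
Qed.

(** Both integrands are nonnegative under the constraint on [vs], so the spectral bound on
    [<Sigma u, u>] controls each of them. *)
Lemma Sigma_quadratic : ip (Sigma ip X phi Pp Pm vs u) u =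
  \int[Pp]_(x in X) (y x ^+ 2 * sin (s x)) + \int[Pm]_(x in X) (y x ^+ 2 * cos (s x)).
Proof.
rewrite SigmaE ipDl (sig_plus_mean u).2 (sig_minus_mean u).2.
by congr (_ + _); apply: eq_Rintegral => x _; rewrite ipZl (ipC ip (phi x)) -/(y x); ring.
Qed.

End population_model.

Section tikhonov_bias_of_range.
Context {R : realType} {H : completeNormedModType R}.
Variable ip : {dot H for (@idfun R)}.
Hypothesis hn : hilbert_norm ip.

Lemma tikhonov_bias_range (A : H -> H) (b : R) (v u0 : H) : A 0 = 0 -> 0 < b <= 1 ->
  frac_pow ip A b u0 = v -> forall lam, 0 < lam ->
  exists w, [/\ `|w| <= lam `^ b * `|u0|,
    `|A w + lam *: (v + w)| <= lam * lam `^ b &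
    b <= 1 / 2 -> ip (A w) w <= lam * (lam `^ b * `|u0|) ^+ 2].
Proof.
move=> A0 b01 fv lam l0.
have [[B HB]|noB] := pselect (exists B, is_frac_pow ip A b B).
  have [e [mu [sd cv]]] : is_frac_pow ip A b (frac_pow ip A b).
    by rewrite /frac_pow; apply: xgetPex; exists B.
  by apply: (tikhonov_bias hn sd b01 l0); rewrite -fv; exact: cv.
(* Without a fractional power, [frac_pow] is its default, the zero map. Then [v = 0], and the zero
   bias satisfies all three bounds. *)
have v0 : v = 0.
  by rewrite -fv /frac_pow xgetPN// => B HB; apply: noB; exists B.
exists 0; rewrite v0 normr0 A0 addr0 scaler0 addr0 normr0 ip0r; split => //.
- by rewrite mulr_ge0 ?powR_ge0.
- by rewrite mulr_ge0 ?powR_ge0 ?ltW.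
- by move=> _; rewrite mulr_ge0 ?sqr_ge0 ?ltW.
Qed.

End tikhonov_bias_of_range.

(** * Probabilistic control of the basic inequality *)

Section estimation_error.
Context {R : realType} {H : completeNormedModType R}.
Variable ip : {dot H for (@idfun R)}.
Context d {T : measurableType d}.
Variables (X : set T) (phi : T -> H).
Hypothesis mX : measurable X.
Hypothesis Hrkhs : rkhs ip X phi.
Hypothesis Hker : measurable_rkhs_kernel ip X phi.
Hypothesis phi_le1 : forall x, X x -> `|phi x| <= 1.
Variables (Pp Pm : probability T R) (vs : H).

Let hn : hilbert_norm ip := Hrkhs.1.

(** Taking [v = vs] shows that [phi x] is nonzero; then [vs + t phi x / |phi x|] and
    [vs - t phi x / |phi x|] are the extremal points of the ball for evaluation at [x]. *)
Lemma interior_point_ball (t : R) (x : T) : 0 < t ->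
  (forall v, `|v - vs| ^+ 2 <= t ^+ 2 -> 0 < feval ip phi v x < pi / 2) ->
  interior_point ip phi vs t x.
Proof.
move=> t0 ball.
have t2 : 0 <= t ^+ 2 by rewrite sqr_ge0.
have phi0 : phi x != 0.
  apply/negP => /eqP p0; have := ball vs; rewrite subrr normr0 expr0n/= => /(_ t2).
  by rewrite /feval p0 ip0r ltxx.
have np : 0 < `|phi x| by rewrite normr_gt0.
have shift (k : R) : `|k| = 1 -> 0 < ip vs (phi x) + k * (t * `|phi x|) < pi / 2.
  move=> k1; have := ball (vs + (k * t / `|phi x|) *: phi x).
  rewrite addrAC subrr add0r normrZ !normrM k1 mul1r normfV normr_id divfK ?gt_eqF//.
  rewrite (gtr0_norm t0) lexx => /(_ isT); rewrite /feval ipDl ipZl -hn.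
  rewrite (_ : k * t / `|phi x| * `|phi x| ^+ 2 = k * (t * `|phi x|)) 1?addrC//.
  by field; rewrite gt_eqF.
have := shift 1 (normr1 _); have := shift (- 1); rewrite normrN1 => /(_ erefl).
by rewrite /interior_point; lra.
Qed.

Section one_sample_size.
Context d' {Omega : measurableType d'} (P : probability Omega R).
Variables xp xm : nat -> {RV P >-> T}.
Hypothesis Hiid : iid_samples X Pp Pm xp xm.

Lemma iid_samples_plus n (A : nat -> set T) : (forall i, measurable (A i)) ->
  P (\bigcap_(i in `I_n) (xp i @^-1` A i)) = (\prod_(i < n) P (xp i @^-1` A i))%E.
Proof.
case: Hiid => _ _ _ ind mA.
have := ind n 0%N A (fun=> setT) mA (fun=> measurableT).
rewrite big_ord0 mule1 => <-; congr (P _).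
by apply/seteqP; split => [w h|w []//]; split => // j.
Qed.

Lemma iid_samples_minus n (A : nat -> set T) : (forall i, measurable (A i)) ->
  P (\bigcap_(i in `I_n) (xm i @^-1` A i)) = (\prod_(i < n) P (xm i @^-1` A i))%E.
Proof.
case: Hiid => _ _ _ ind mA.
have := ind 0%N n (fun=> setT) A (fun=> measurableT) mA.
rewrite big_ord0 mul1e => <-; congr (P _).
by apply/seteqP; split => [w h|w []//]; split => // j.
Qed.

Variable u : H.

(** On [E] the basic inequality is deterministic once both empirical gradients and both quartic
    averages are controlled. A union bound adds two Chebyshev and two Markov terms to the complement
    of [E]. [B] keeps the constants free of [u], which varies with the sample size. *)
Lemma error_prob_le (np nm : nat) (E : set Omega) (t lam r A q I C B : R)
    (vhat : Omega -> H) (psip psim : T -> R) :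
  mean_grad ip X phi Pp Pm vs = 0 ->
  (0 < np)%N -> (0 < nm)%N -> 0 <= t -> `|u| <= t / 2 -> `|u| <= B -> 0 < r -> 0 < q ->
  (forall w, E w -> on_sample np nm (xp ^~ w) (xm ^~ w) (interior_point ip phi vs t)) ->
  (forall w, E w -> estimator ip phi np nm (xp ^~ w) (xm ^~ w) lam (vhat w)) ->
  `|Sigma ip X phi Pp Pm vs u + lam *: (vs + u)| <= A ->
  measurable_fun X psip -> measurable_fun X psim ->
  (forall x, X x -> 0 <= psip x <= C) -> (forall x, X x -> 0 <= psim x <= C) ->
  (forall x, X x -> interior_point ip phi vs t x ->
     ip u (phi x) ^+ 4 / sin (ip vs (phi x)) <= psip x) ->
  (forall x, X x -> interior_point ip phi vs t x ->
     ip u (phi x) ^+ 4 / cos (ip vs (phi x)) <= psim x) ->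
  \int[Pp]_(x in X) psip x <= I -> \int[Pm]_(x in X) psim x <= I ->
  (mu_ext P [set w | ((2 * r + A) * `|vhat w - (vs + u)| + 2 * q <
      lam / 2 * `|vhat w - (vs + u)| ^+ 2)%R] <=
   mu_ext P (~` E) + (4 * (B + 1) ^+ 2 / (np%:R * r ^+ 2) +
     4 * (B + 1) ^+ 2 / (nm%:R * r ^+ 2) + I / q + I / q)%:E)%E.
Proof.
move=> grad0 np0 nm0 t0 ut uB r0 q0 EI Eest bias mpp mpm ppC pmC ppP pmP ppI pmI.
case: (Hiid) => xX xpQ xmQ _.
have xpX i w : X (xp i w) := (xX i w).1.
have xmX i w : X (xm i w) := (xX i w).2.
have B0 : 0 <= B + 1 by rewrite addr_ge0// (le_trans _ uB).
pose m1 := mean ip Pp X (fun x => model_plus ip phi vs u x *: phi x).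
pose m2 := mean ip Pm X (fun x => model_minus ip phi vs u x *: phi x).
have c1B x : X x -> `|model_plus ip phi vs u x| <= B + 1.
  by move=> Xx; rewrite (le_trans (model_plus_le Hrkhs phi_le1 vs u Xx))// lerD2r.
have c2B x : X x -> `|model_minus ip phi vs u x| <= B + 1.
  by move=> Xx; rewrite (le_trans (model_minus_le Hrkhs phi_le1 vs u Xx))// lerD2r.
have mc1 := measurable_model_plus mX Hrkhs Hker vs u.
have mc2 := measurable_model_minus mX Hrkhs Hker vs u.
have m1P := mean_is_mean mX Hrkhs Hker phi_le1 Pp mc1 c1B.
have m2P := mean_is_mean mX Hrkhs Hker phi_le1 Pm mc2 c2B.
pose A1 := [set w | (r < `|np%:R^-1 *: \sum_(i < np) model_plus ip phi vs u (xp i w) *: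
  phi (xp i w) - m1|)%R].
pose A2 := [set w | (r < `|nm%:R^-1 *: \sum_(i < nm) model_minus ip phi vs u (xm i w) *:
  phi (xm i w) - m2|)%R].
pose A3 := [set w | (q < np%:R^-1 * \sum_(i < np) psip (xp i w))%R].
pose A4 := [set w | (q < nm%:R^-1 * \sum_(i < nm) psim (xm i w))%R].
have PA1 : (mu_ext P A1 <= (4 * (B + 1) ^+ 2 / (np%:R * r ^+ 2))%:E)%E.
  exact: (empirical_mean_chebyshev mX Hrkhs Hker phi_le1 mc1 c1B m1P xpX xpQ
    iid_samples_plus np0 B0 r0).
have PA2 : (mu_ext P A2 <= (4 * (B + 1) ^+ 2 / (nm%:R * r ^+ 2))%:E)%E.
  exact: (empirical_mean_chebyshev mX Hrkhs Hker phi_le1 mc2 c2B m2P xmX xmQ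
    iid_samples_minus nm0 B0 r0).
have PA3 : (mu_ext P A3 <= (I / q)%:E)%E.
  apply: (le_trans (empirical_mean_markov mX xpX xpQ np q0 mpp ppC)).
  by rewrite lee_fin ler_wpM2r// invr_ge0 ltW.
have PA4 : (mu_ext P A4 <= (I / q)%:E)%E.
  apply: (le_trans (empirical_mean_markov mX xmX xmQ nm q0 mpm pmC)).
  by rewrite lee_fin ler_wpM2r// invr_ge0 ltW.
rewrite !EFinD.
apply: (@le_trans _ _ (mu_ext P (~` E `|` (A1 `|` A2 `|` A3 `|` A4)))).
  apply: le_mu_ext => w; rewrite /= => hw.
  have [Ew|] := pselect (E w); last by left.
  have [hA1|nA1] := pselect (A1 w); first by right; do 3 left.
  have [hA2|nA2] := pselect (A2 w); first by right; do 2 left; right.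
  have [hA3|nA3] := pselect (A3 w); first by right; left; right.
  have [hA4|nA4] := pselect (A4 w); first by right; right.
  move: nA1 nA2 nA3 nA4 => /negP nA1 /negP nA2 /negP nA3 /negP nA4.
  rewrite -!leNgt in nA1 nA2 nA3 nA4.
  have [ip_ im_] := EI _ Ew.
  have := @estimator_basic_inequality _ _ ip hn _ _ phi vs u np nm (xp ^~ w) (xm ^~ w)
    t lam r A q m1 m2 (vhat w) psip psim t0 ut (EI _ Ew) _ _ (Eest _ Ew) nA1 nA2 _ nA3 nA4.
  have h1 i : (i < np)%N -> ip u (phi (xp i w)) ^+ 4 / sin (ip vs (phi (xp i w))) <= psip (xp i w).
    by move=> hi; apply: ppP => //; exact: ip_.
  have h2 i : (i < nm)%N -> ip u (phi (xm i w)) ^+ 4 / cos (ip vs (phi (xm i w))) <= psim (xm i w).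
    by move=> hi; apply: pmP => //; exact: im_.
  have h3 : `|m1 + m2 + lam *: (vs + u)| <= A.
    by rewrite (model_mean_sum mX Hrkhs Hker phi_le1 u grad0).
  by move=> /(_ h1 h2 h3); rewrite leNgt hw.
by do ![apply: (le_trans (outer_measureU2 _ _ _)); apply: leeD => //].
Qed.

End one_sample_size.

(** * Majorants of the quartic remainder *)

Section majorant.
Variables (K beta : R).
Hypothesis K0 : 0 < K.
Hypothesis beta01 : 0 < beta <= 1.
Hypothesis vs_range : forall x, X x -> 0 <= ip vs (phi x) <= pi / 2.

Let level (m : nat) := K / m%:R `^ beta.

(** The shift is at most half the distance to either end, hence at most the sine (or cosine) in the
    denominator, by [half_le_sin]. The resulting majorants are the integrands of [<Sigma u, u>]. *)
Lemma quartic_majorant_low (t : R) (u : H) x : 0 <= t -> `|u| <= t / 2 ->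
  interior_point ip phi vs t x ->
  ip u (phi x) ^+ 4 / sin (ip vs (phi x)) <= ip u (phi x) ^+ 2 * sin (ip vs (phi x)) /\
  ip u (phi x) ^+ 4 / cos (ip vs (phi x)) <= ip u (phi x) ^+ 2 * cos (ip vs (phi x)).
Proof.
move=> t0 ut ix; have [y1 y2 _] := interior_shift hn ut ix.
have s0 := interior_point_gt0 t0 ix.
move: y1 y2 s0; move: (ip u (phi x)) (ip vs (phi x)) => y s y1 y2 s0.
have key (z S : R) : 0 < z < pi / 2 -> S = sin z -> `|y| <= z / 2 -> y ^+ 4 / S <= y ^+ 2 * S.
  move=> z0 -> yz; have S0 := sin_gt0_pihalf z0.
  rewrite ler_pdivrMr// -mulrA -expr2 (_ : y ^+ 4 = y ^+ 2 * y ^+ 2); last by ring.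
  have yS : `|y| <= sin z by apply: (le_trans yz); apply: half_le_sin; lra.
  rewrite ler_wpM2l ?sqr_ge0// -[leLHS](real_normK (num_real y)).
  by rewrite lerXn2r ?nnegrE// ltW.
split; first exact: (key s).
apply: (key (pi / 2 - s)) => //; first lra.
by rewrite -opprB sinN sinBpihalf opprK.
Qed.

(** As [|phi x| <= 1], the fourth power is at most [D^4 |phi x|]. The denominator is at least half
    the distance to the boundary, and [boundary_weightP] bounds [|phi x|] over that distance. *)
Lemma quartic_majorant_high (t D : R) (a n : nat) (u : H) x : X x -> (0 < a)%N -> (a <= n)%N ->
  0 <= t -> level n <= t -> `|u| <= D ->
  interior_point ip phi vs t x ->
  ip u (phi x) ^+ 4 / sin (ip vs (phi x)) <=
    2 * D ^+ 4 / K * boundary_weight ip X phi vs K beta a n x /\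
  ip u (phi x) ^+ 4 / cos (ip vs (phi x)) <=
    2 * D ^+ 4 / K * boundary_weight ip X phi vs K beta a n x.
Proof.
move=> Xx a0 an t0 lt uD ix.
have s0 := interior_point_gt0 t0 ix.
have [w1 w2] := boundary_weightP K0 beta01 a0 an Xx (interior_pointS lt ix).
have g0 := (andP (boundary_weight_bound ip X phi vs K beta a n x)).1.
move: w1 w2 g0; set g := boundary_weight _ _ _ _ _ _ _ _ _ => w1 w2 g0.
have f1 := phi_le1 Xx.
have D0 : 0 <= D by exact: le_trans uD.
have yD : `|ip u (phi x)| <= D * `|phi x|.
  by apply: (le_trans (CauchySchwarz_ip hn _ _)); rewrite ler_wpM2r.
have y4 : ip u (phi x) ^+ 4 <= D ^+ 4 * `|phi x|.
  rewrite (_ : _ ^+ 4 = `|ip u (phi x)| ^+ 4); last first.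
    by rewrite -normrX ger0_norm// exprn_even_ge0.
  apply: (@le_trans _ _ ((D * `|phi x|) ^+ 4)).
    by rewrite lerXn2r ?nnegrE ?mulr_ge0.
  rewrite exprMn ler_wpM2l ?exprn_ge0// exprS -[leRHS]mulr1 ler_wpM2l//.
  exact: exprn_ile1.
have key (z S : R) : 0 < z < pi / 2 -> S = sin z -> K * `|phi x| <= z * g ->
    ip u (phi x) ^+ 4 / S <= 2 * D ^+ 4 / K * g.
  move=> z0 -> zg; have S0 := sin_gt0_pihalf z0.
  rewrite ler_pdivrMr//; apply: (le_trans y4).
  have zS : z / 2 <= sin z by apply: half_le_sin; lra.
  apply: (@le_trans _ _ (2 * D ^+ 4 / K * g * (z / 2))); last first.
    by rewrite ler_wpM2l// mulr_ge0// divr_ge0 ?(ltW K0)// mulr_ge0// exprn_ge0.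
  rewrite (_ : 2 * D ^+ 4 / K * g * (z / 2) = D ^+ 4 * ((z * g) / K)); last first.
    by field; rewrite gt_eqF.
  by rewrite ler_wpM2l ?exprn_ge0// ler_pdivlMr// mulrC.
split; first exact: (key (ip vs (phi x))).
apply: (key (pi / 2 - ip vs (phi x))) => //; first lra.
by rewrite -opprB sinN sinBpihalf opprK.
Qed.

(** Both regimes of [beta] reach the order [tau * tau^(2 beta)], the first through [quad], the
    second through the boundary weight. [C] only ensures integrability and may grow with [n],
    whereas the integral bounds involve the fixed [a]. *)
Lemma quartic_majorant (a n : nat) (B tau t : R) (u : H) : (0 < a)%N -> (a <= n)%N ->
  (forall m, (a <= m)%N -> fine (Pp (boundary ip X phi vs (level m))) <= (m%:R ^+ 2)^-1) ->
  (forall m, (a <= m)%N -> fine (Pm (boundary ip X phi vs (level m))) <= (m%:R ^+ 2)^-1) ->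
  0 < tau <= 1 -> 0 <= t -> level n <= t -> `|u| <= t / 2 -> `|u| <= tau `^ beta * B ->
  (beta <= 1 / 2 -> ip (Sigma ip X phi Pp Pm vs u) u <= tau * (tau `^ beta * B) ^+ 2) ->
  exists (psip psim : T -> R) (C : R), [/\ measurable_fun X psip /\ measurable_fun X psim,
    (forall x, X x -> 0 <= psip x <= C), (forall x, X x -> 0 <= psim x <= C),
    (forall x, X x -> interior_point ip phi vs t x ->
      ip u (phi x) ^+ 4 / sin (ip vs (phi x)) <= psip x /\
      ip u (phi x) ^+ 4 / cos (ip vs (phi x)) <= psim x) &
    \int[Pp]_(x in X) psip x <= (B ^+ 2 + 2 * B ^+ 4 / K * (a%:R + 2)) * (tau * (tau `^ beta) ^+ 2) /\
    \int[Pm]_(x in X) psim x <= (B ^+ 2 + 2 * B ^+ 4 / K * (a%:R + 2)) * (tau * (tau `^ beta) ^+ 2)].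
Proof.
move=> a0 an tailp tailm /andP[tau0 tau1] t0 lt ut uB quad.
have ms := measurable_sin_feval mX Hrkhs Hker vs.
have mc := measurable_cos_feval mX Hrkhs Hker vs.
have p0 : 0 < tau `^ beta by exact: powR_gt0.
have B0 : 0 <= B by rewrite -(pmulr_rge0 _ p0) (le_trans _ uB).
set w := tau * _; have w0 : 0 <= w by rewrite mulr_ge0 ?sqr_ge0 ?ltW.
have c0 : 0 <= 2 * B ^+ 4 / K * (a%:R + 2).
  by rewrite mulr_ge0 ?addr_ge0// divr_ge0 ?(ltW K0)// mulr_ge0// exprn_ge0.
have [b2|b2] := leP beta (1 / 2).
  pose psip x := ip u (phi x) ^+ 2 * sin (ip vs (phi x)).
  pose psim x := ip u (phi x) ^+ 2 * cos (ip vs (phi x)).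
  have y2 x : X x -> ip u (phi x) ^+ 2 <= `|u| ^+ 2.
    move=> Xx; rewrite -(real_normK (num_real (ip u (phi x)))) lerXn2r ?nnegrE//.
    exact: (feval_le Hrkhs phi_le1).
  have sb x : X x -> 0 <= psip x <= `|u| ^+ 2.
    move=> Xx; have S0 : 0 <= sin (ip vs (phi x)) by exact/sin_ge0_pihalf/vs_range.
    by rewrite /psip mulr_ge0 ?sqr_ge0//= -[leRHS]mulr1 ler_pM ?sqr_ge0 ?y2 ?sin_le1.
  have cb x : X x -> 0 <= psim x <= `|u| ^+ 2.
    move=> Xx; have S0 : 0 <= cos (ip vs (phi x)).
      by apply: cos_ge0_pihalf; have := vs_range Xx; have := @pi_gt0 R; lra.
    by rewrite /psim mulr_ge0 ?sqr_ge0//= -[leRHS]mulr1 ler_pM ?sqr_ge0 ?y2 ?cos_le1.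
  have my2 : measurable_fun X (fun x => ip u (phi x) ^+ 2).
    by apply: measurable_funX; exact: (measurable_feval mX Hrkhs Hker u).
  exists psip, psim, (`|u| ^+ 2); split => //.
  - by split; apply: measurable_funM.
  - by move=> x Xx; exact: quartic_majorant_low.
  have := quad b2; rewrite (Sigma_quadratic mX Hrkhs Hker phi_le1 vs u Pp Pm).
  have i1 : 0 <= \int[Pp]_(x in X) psip x by apply: Rintegral_ge0 => x /sb /andP[].
  have i2 : 0 <= \int[Pm]_(x in X) psim x by apply: Rintegral_ge0 => x /cb /andP[].
  have -> : tau * (tau `^ beta * B) ^+ 2 = B ^+ 2 * w by rewrite /w; ring.
  have : B ^+ 2 * w <= (B ^+ 2 + 2 * B ^+ 4 / K * (a%:R + 2)) * w.
    by rewrite ler_wpM2r// lerDl.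
  rewrite -/(psip _); lra.
set D := tau `^ beta * B.
have D0 : 0 <= D by rewrite mulr_ge0// ltW.
pose psi x := 2 * D ^+ 4 / K * boundary_weight ip X phi vs K beta a n x.
have k0 : 0 <= 2 * D ^+ 4 / K by rewrite divr_ge0 ?(ltW K0)// mulr_ge0// exprn_ge0.
have mg := measurable_boundary_weight mX Hrkhs Hker vs K beta a n.
have psib x : X x -> 0 <= psi x <= 2 * D ^+ 4 / K * (a%:R + n%:R).
  move=> Xx; have /andP[g0 g1] := boundary_weight_bound ip X phi vs K beta a n x.
  by rewrite mulr_ge0//= ler_wpM2l.
(* Here [2 beta >= 1] and [tau <= 1] give [tau^(4 beta) <= tau^(1 + 2 beta)]. *)
have ppw : (tau `^ beta) ^+ 4 <= w.
  rewrite (_ : (tau `^ beta) ^+ 4 = (tau `^ beta) ^+ 2 * (tau `^ beta) ^+ 2); last by ring.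
  rewrite ler_wpM2r ?sqr_ge0// expr2 -powRD; last by rewrite (gt_eqF tau0) implybT.
  rewrite -[leRHS]powRr1 ?(ltW tau0)//.
  by apply: ger_powR; [rewrite tau0 | lra].
have iI (Q : probability T R) :
    (forall m, (a <= m)%N -> fine (Q (boundary ip X phi vs (level m))) <= (m%:R ^+ 2)^-1) ->
    \int[Q]_(x in X) psi x <= (B ^+ 2 + 2 * B ^+ 4 / K * (a%:R + 2)) * w.
  move=> tail; rewrite RintegralZl//; last first.
    apply: (bounded_integrable Q mX mg (C := a%:R + n%:R)) => x _.
    have /andP[g0 g1] := boundary_weight_bound ip X phi vs K beta a n x.
    by rewrite ger0_norm.
  have := boundary_weight_mean_le mX Hrkhs Hker (K := K) (beta := beta) a0 an tail.
  move=> /(ler_wpM2l k0) h; apply: (le_trans h).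
  rewrite (_ : 2 * D ^+ 4 / K * (a%:R + 2) =
    2 * B ^+ 4 / K * (a%:R + 2) * (tau `^ beta) ^+ 4); last by rewrite /D; ring.
  apply: (le_trans (ler_wpM2l c0 ppw)).
  by rewrite ler_wpM2r// lerDr sqr_ge0.
exists psi, psi, (2 * D ^+ 4 / K * (a%:R + n%:R)); split => //.
- by split; apply: measurable_funM.
- by move=> x Xx ix; apply: (quartic_majorant_high Xx a0 an t0 lt uB ix).
- by split; exact: iI.
Qed.

End majorant.
End estimation_error.

(** Divide by [tau] and use [tau <= p]. If [z] exceeded the claimed bound it would exceed [p], so
    [p^2 <= p z]; dividing by [z] then gives [z <= (4 M1 + 4 M2 + 2) p], a contradiction. *)
Lemma quadratic_inequality_bound (R : realType) (tau p z M1 M2 : R) :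
  0 < tau -> tau <= p -> 0 <= M1 -> 0 <= M2 -> 0 <= z ->
  tau / 2 * z ^+ 2 <= (2 * (M1 * tau ^+ 2) + tau * p) * z + 2 * (M2 * (tau * p ^+ 2)) ->
  z <= (4 * M1 + 4 * M2 + 3) * p.
Proof.
move=> t0 tp M10 M20 z0 h.
have p0 : 0 < p by exact: lt_le_trans tp.
have h1 : z ^+ 2 / 2 <= (2 * M1 * tau + p) * z + 2 * M2 * p ^+ 2.
  rewrite -(ler_pM2l t0).
  rewrite (_ : tau * (z ^+ 2 / 2) = tau / 2 * z ^+ 2); last by ring.
  by apply: (le_trans h); rewrite le_eqVlt; apply/orP; left; apply/eqP; ring.
have h2 : z ^+ 2 / 2 <= (2 * M1 + 1) * p * z + 2 * M2 * p ^+ 2.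
  apply: (le_trans h1); rewrite lerD2r ler_wpM2r//.
  have : M1 * tau <= M1 * p by rewrite ler_wpM2l.
  lra.
rewrite leNgt; apply/negP => zL.
have pz : p <= z by nra.
have h3 : M2 * (p * p) <= M2 * (p * z) by rewrite !ler_wpM2l// ltW.
have h4 : z * (z / 2) <= z * ((2 * M1 + 1 + 2 * M2) * p) by nra.
have z1 : 0 < z by exact: lt_le_trans pz.
rewrite (ler_pM2l z1) in h4; nra.
Qed.

Theorem theorem1 (R : realType)
    (* the input space, the RKHS and its feature map *)
    (d : nat) (X : set (d.-tuple R)) (mX : measurable X)
    (H : completeNormedModType R) (ip : {dot H for (@idfun R)})
    (phi : d.-tuple R -> H)
    (Hrkhs : rkhs ip X phi) (Hker : measurable_rkhs_kernel ip X phi)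
    (phi_le1 : forall x, X x -> `|phi x| <= 1)
    (* the two populations and the samples *)
    (p_plus p_minus : d.-tuple R -> R) (Pp Pm : probability (d.-tuple R) R)
    (Hp : has_density X Pp p_plus) (Hm : has_density X Pm p_minus)
    (dO : measure_display) (Omega : measurableType dO) (P : probability Omega R)
    (xp xm : nat -> {RV P >-> d.-tuple R})
    (Hiid : iid_samples X Pp Pm xp xm)
    (* (1) *)
    (vstar : H)
    (Hvstar : unique (is_population_solution ip X phi Pp Pm) vstar)
    (* (3) *)
    (beta : R) (beta_gt0 : 0 < beta) (beta_le1 : beta <= 1)
    (Hrange : range (frac_pow ip (Sigma ip X phi Pp Pm vstar) beta) vstar) :
  exists T K : R, 1 <= T /\ 0 < K /\
    forall (delta : nat -> R) (lam : nat -> R) (vhat : nat -> nat -> Omega -> H),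
      (* (2) *)
      (forall n, 0 < delta n) ->
      nonincreasing_seq delta ->
      with_prob_tending_to_1 P (fun np nm => [set w | forall v : H,
        `|v - vstar| ^+ 2 <= delta (minn np nm) ^+ 2 ->
        on_sample np nm (xp ^~ w) (xm ^~ w)
          (fun x => 0 < feval ip phi v x < pi / 2)]) ->
      (* (4) *)
      (forall np nm w, (0 < minn np nm)%N ->
        estimator ip phi np nm (xp ^~ w) (xm ^~ w) (lam (minn np nm))
          (vhat np nm w)) ->
      (* choice of lambda and range of delta *)
      (forall n, (0 < n)%N -> lam n = T / n%:R `^ (1 / 4)) ->
      (\forall n \near \oo, K / n%:R `^ (beta / 4) <= delta n <=
         1 / (4 * Num.max (Bconst ip X phi Pp Pm Pp vstar (lam n))
                          (Bconst ip X phi Pp Pm Pm vstar (lam n)))) ->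
      exists N : nat, (0 < N)%N /\
        bigOp_above P N (fun np nm w => `|vhat np nm w - vstar|)
          (fun n => n%:R `^ (- (beta / 4))).
Proof.
have hn : hilbert_norm ip := Hrkhs.1.
have [[grad0 vs_range] _] := Hvstar.
have [u0 _ fu0] := Hrange.
have beta01 : 0 < beta <= 1 by rewrite beta_gt0.
set B := `|u0|; have B0 : 0 <= B by exact: normr_ge0.
(* [2 B] ensures [|u| <= p B <= delta n / 2] for the bias [u]; the added 1 keeps [K] positive when
   [u0 = 0]. *)
set K := 2 * B + 1; have K0 : 0 < K by rewrite /K ltr_wpDl// mulr_ge0.
exists 1, K; split => //; split => // delta lam vhat delta0 _ wp est lamE [ND _ dK].
pose E np nm := [set w | forall v : H, `|v - vstar| ^+ 2 <= delta (minn np nm) ^+ 2 ->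
  on_sample np nm (xp ^~ w) (xm ^~ w) (fun x => 0 < feval ip phi v x < pi / 2)].
have EI np nm w : E np nm w -> on_sample np nm (xp ^~ w) (xm ^~ w)
    (interior_point ip phi vstar (delta (minn np nm))).
  move=> Ew; split => i hi; apply: (interior_point_ball Hrkhs (delta0 _)) => v /Ew[h1 h2].
    exact: h1.
  exact: h2.
(* The tail estimate uses hypothesis (2) at the fixed level 1/2, so [N0], and with it [a] and the
   bound on the mean weight, are independent of [eps]. *)
have [N0 wp0] : exists N, forall np nm, (N <= minn np nm)%N ->
    (mu_ext P (~` E np nm) <= (2^-1)%:E)%E by apply: wp.
pose level (m : nat) := K / m%:R `^ beta.
have level4 m : (0 < m)%N -> K / (m ^ 4)%:R `^ (beta / 4) = level m.
  move=> m0; rewrite /level; congr (_ / _).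
  by rewrite natrX -powR_mulrn// -powRrM; congr (_ `^ _); rewrite mulrC divfK.
pose a := (maxn N0 ND).+1.
have a0 : (0 < a)%N by [].
have aN0 m : (a <= m)%N -> (N0 <= m)%N.
  by move=> am; rewrite (leq_trans _ am)// leqW// leq_maxl.
have aND m : (a <= m)%N -> (ND <= m)%N.
  by move=> am; rewrite (leq_trans _ am)// leqW// leq_maxr.
have le_pow4 m : (0 < m)%N -> (m <= m ^ 4)%N.
  by move=> m0; rewrite -{1}[m]expn1 leq_pexp2l.
have tail (Q : probability (d.-tuple R) R) (x : nat -> {RV P >-> d.-tuple R}) :
    (forall i A, measurable A -> P (x i @^-1` A) = Q A) ->
    (forall n (A : nat -> set (d.-tuple R)), (forall i, measurable (A i)) ->
      P (\bigcap_(i in `I_n) (x i @^-1` A i)) = (\prod_(i < n) P (x i @^-1` A i))%E) ->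
    (forall n w i, (i < n)%N -> E n n w -> interior_point ip phi vstar (delta n) (x i w)) ->
    forall m, (a <= m)%N -> fine (Q (boundary ip X phi vstar (level m))) <= (m%:R ^+ 2)^-1.
  move=> xQ xind xE m am; have m0 : (0 < m)%N := leq_trans a0 am.
  have m40 : (0 < m ^ 4)%N by rewrite expn_gt0 m0.
  have am4 : (a <= m ^ 4)%N := leq_trans am (le_pow4 _ m0).
  (* With [m^4] samples in each class, the layer at [level m] is avoided with probability at least
     1/2. Its mass is thus at most [m^-4], weakened to the summable [m^-2]. *)
  apply: (@le_trans _ _ ((m ^ 4)%:R^-1)).
    apply: (avoided_set_prob_le xQ xind (E := E (m ^ 4)%N (m ^ 4)%N)) => //.
    - exact: (measurable_boundary mX Hrkhs Hker).
    - by apply: wp0; rewrite minnn; exact: aN0.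
    - move=> w Ew i hi [_]; apply.
      apply: (interior_pointS _ (xE _ _ _ hi Ew)).
      by rewrite -level4//; have /andP[] := dK _ (aND _ am4).
  rewrite lef_pV2 ?posrE ?exprn_gt0 ?ltr0n// natrX.
  by rewrite ler_weXn2l// ler1n.
have tailp := tail Pp xp.
have tailm := tail Pm xm.
have {}tailp : forall m, (a <= m)%N ->
    fine (Pp (boundary ip X phi vstar (level m))) <= (m%:R ^+ 2)^-1.
  apply: tailp; first by case: Hiid.
    exact: (iid_samples_plus Hiid).
  by move=> n w i hi /EI[]; rewrite minnn => h _; exact: h.
have {}tailm : forall m, (a <= m)%N ->
    fine (Pm (boundary ip X phi vstar (level m))) <= (m%:R ^+ 2)^-1.
  apply: tailm; first by case: Hiid.
    exact: (iid_samples_minus Hiid).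
  by move=> n w i hi /EI[]; rewrite minnn => _ h; exact: h.
(* This serves the case where [frac_pow] takes its default value and the bias is 0. *)
have Sigma0 : Sigma ip X phi Pp Pm vstar 0 = 0.
  have z (f : d.-tuple R -> R) (Q : probability (d.-tuple R) R) :
      mean ip Q X (fun x => f x *: tensor ip (phi x) 0) = 0.
    rewrite (_ : (fun x => _) = (fun x => (fun=> 0) x *: phi x)); last first.
      by apply/funext => x; rewrite /tensor ip0l !scale0r scaler0.
    have c0 x : X x -> `|(fun=> 0) x : R| <= 0 by rewrite normr0.
    have m0 : measurable_fun X ((fun=> 0) : d.-tuple R -> R) by exact: measurable_cst.
    apply/eqP; rewrite -normr_le0.
    exact: (mean_norm_le mX Hrkhs Hker phi_le1 m0 c0
      (mean_is_mean mX Hrkhs Hker phi_le1 Q m0 c0)).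
  by rewrite /Sigma !z addr0.
exists 1%N; split => // eps eps0.
have [N1 wp1] : exists N, forall np nm, (N <= minn np nm)%N ->
    (mu_ext P (~` E np nm) <= (eps / 2)%:E)%E by apply: wp; rewrite divr_gt0.
pose I0 := B ^+ 2 + 2 * B ^+ 4 / K * (a%:R + 2).
have I00 : 0 <= I0.
  by rewrite addr_ge0 ?sqr_ge0// mulr_ge0 ?addr_ge0// divr_ge0 ?(ltW K0)// mulr_ge0// exprn_ge0.
(* [M1] and [M2] are tuned so that each Chebyshev term and each Markov term is at most [eps / 8];
   the leading 1 gives [M1 <= M1^2], which the Chebyshev terms need. *)
pose M1 := 1 + 32 * (B + 1) ^+ 2 / eps.
pose M2 := 1 + 8 * I0 / eps.
have M11 : 1 <= M1.
  by rewrite lerDl divr_ge0 ?(ltW eps0)// mulr_ge0// sqr_ge0.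
have M21 : 1 <= M2 by rewrite lerDl divr_ge0 ?(ltW eps0)// mulr_ge0.
(* The first three terms bound the distance from the estimator to [vstar + u] by
   [quadratic_inequality_bound]; [B] accounts for [|u| <= p B]. *)
exists (4 * M1 + 4 * M2 + 3 + B), (maxn a N1) => np nm n1 nN.
set n := minn np nm in n1 nN *.
have n0 : (0 < n)%N by exact: leq_trans n1.
have nR : 0 < n%:R :> R by rewrite ltr0n.
have an : (a <= n)%N := leq_trans (leq_maxl _ _) nN.
have np0 : (0 < np)%N by rewrite (leq_trans n0)// geq_minl.
have nm0 : (0 < nm)%N by rewrite (leq_trans n0)// geq_minr.
pose tau := n%:R `^ (- (1 / 4)) : R.
pose p := tau `^ beta.
have tau0 : 0 < tau by exact: powR_gt0.
have p0 : 0 < p by exact: powR_gt0.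
have lam_tau : lam n = tau by rewrite lamE// /tau powRN [LHS]div1r.
have tau1 : tau <= 1.
  by rewrite /tau powRN invf_le1 ?powR_gt0// -[leLHS](powRr0 n%:R) ler_powR// ?ler1n//; lra.
have taup : tau <= p.
  by rewrite /p ger1_powR// tau0.
have p1 : p <= 1.
  have e1 : 1 `^ beta = 1 :> R by rewrite powR1.
  by rewrite -[leRHS]e1; apply: ge0_ler_powR; rewrite ?nnegrE ?(ltW tau0)// ltW.
have pE : n%:R `^ (- (beta / 4)) = p.
  by rewrite /p /tau -powRrM; congr (_ `^ _); field.
(* Thus [tau^2 = n^(-1/2)], the order of the fluctuations of an empirical mean. *)
have ntau4 : n%:R * tau ^+ 4 = 1.
  rewrite -powR_mulrn ?ltW// /tau -powRrM (_ : - (1 / 4) * 4%:R = - 1); last by field.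
  by rewrite powR_inv1 ?ltW// divff// gt_eqF.
have /andP[Kdelta _] := dK _ (aND _ an).
have Kp : K / n%:R `^ (beta / 4) = K * p by rewrite -pE powRN.
rewrite Kp in Kdelta.
have [u [uB bias quad]] :=
  tikhonov_bias_range hn Sigma0 beta01 fu0 tau0.
rewrite -/p -/B in uB bias quad.
have uB1 : `|u| <= B by rewrite (le_trans uB)// ler_piMl.
have t0 : 0 <= delta n by exact: ltW.
have ut : `|u| <= delta n / 2.
  have : p * B * 2 <= K * p by rewrite /K; nra.
  lra.
(* As [n^(beta/4) <= n^beta], an observed point is interior at level [n], so the boundary weight may
   be truncated at index [n]. *)
have lvl : level n <= delta n.
  apply: le_trans Kdelta; rewrite -Kp /level ler_pM2l// lef_pV2 ?posrE ?powR_gt0//.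
  by apply: ler_powR; rewrite ?ler1n//; lra.
have [psip [psim [C [[mpp mpm] ppC pmC psiP [ppI pmI]]]]] :=
  quartic_majorant mX Hrkhs Hker phi_le1 K0 beta01 vs_range a0 an tailp tailm
    (introT andP (conj tau0 tau1)) t0 lvl ut uB quad.
rewrite -/I0 -/p in ppI pmI.
(* [r] has the scale of the gradient fluctuations and [q] that of the mean quartic remainder. *)
set r := M1 * tau ^+ 2.
set q := M2 * (tau * p ^+ 2).
have r0 : 0 < r by rewrite /r mulr_gt0 ?exprn_gt0//; lra.
have q0 : 0 < q by rewrite /q !mulr_gt0 ?exprn_gt0//; lra.
have := @error_prob_le _ _ ip _ _ X phi mX Hrkhs Hker phi_le1 Pp Pm vstar _ _ P xp xm Hiid u
  np nm (E np nm) (delta n) tau r (tau * p) q (I0 * (tau * p ^+ 2)) C B (vhat np nm) psip psim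
  grad0 np0 nm0 t0 ut uB1 r0 q0 (@EI np nm) _ bias mpp mpm ppC pmC
  (fun x Xx ix => (psiP x Xx ix).1) (fun x Xx ix => (psiP x Xx ix).2) ppI pmI.
have hest w : E np nm w -> estimator ip phi np nm (xp ^~ w) (xm ^~ w) tau (vhat np nm w).
  by move=> _; rewrite -lam_tau; exact: est.
move=> /(_ hest) main.
apply: (@le_trans _ _ (mu_ext P [set w | ((2 * r + tau * p) * `|vhat np nm w - (vstar + u)| + 2 * q <
      tau / 2 * `|vhat np nm w - (vstar + u)| ^+ 2)%R])).
  apply: le_mu_ext => w /=; rewrite normr_id pE => hw.
  rewrite ltNge; apply/negP => hw'.
  have zb := quadratic_inequality_bound tau0 taup (le_trans ler01 M11) (le_trans ler01 M21) (normr_ge0 _) hw'.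
  move: hw; apply/negP; rewrite -leNgt.
  rewrite (_ : vhat np nm w - vstar = (vhat np nm w - (vstar + u)) + u); last first.
    by rewrite opprD addrA subrK.
  apply: (le_trans (ler_normD _ _)); rewrite mulrDl lerD//.
  by rewrite mulrC.
apply: (le_trans main).
have wp1' := wp1 np nm (leq_trans (leq_maxr _ _) nN).
(* Half of [eps] goes to the failure of hypothesis (2), an eighth to each of the four deviation
   events. *)
apply: (@le_trans _ _ ((eps / 2)%:E + (eps / 8 + eps / 8 + eps / 8 + eps / 8)%:E)%E); last first.
  by rewrite -EFinD lee_fin; lra.
apply: leeD => //; rewrite lee_fin.
have cheb k : (n <= k)%N -> 4 * (B + 1) ^+ 2 / (k%:R * r ^+ 2) <= eps / 8.
  move=> nk; have kn : n%:R <= k%:R :> R by rewrite ler_nat.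
  have kr : 0 < k%:R * r ^+ 2 by rewrite mulr_gt0 ?exprn_gt0// (lt_le_trans nR).
  rewrite ler_pdivrMr//.
  have : M1 ^+ 2 <= k%:R * r ^+ 2.
    rewrite /r (_ : k%:R * (M1 * tau ^+ 2) ^+ 2 = M1 ^+ 2 * (k%:R * tau ^+ 4)); last by ring.
    by rewrite ler_peMr ?sqr_ge0// -[leLHS]ntau4 ler_wpM2r ?exprn_ge0// ltW.
  have : M1 <= M1 ^+ 2 by rewrite expr2 ler_peMr// (le_trans ler01).
  have : 4 * (B + 1) ^+ 2 <= eps / 8 * M1.
    rewrite /M1 mulrDr mulr1.
    rewrite (_ : eps / 8 * (32 * (B + 1) ^+ 2 / eps) = 4 * (B + 1) ^+ 2); last first.
      by field; rewrite gt_eqF.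
    by rewrite lerDr divr_ge0 ?ltW.
  move: (4 * _) (k%:R * _) => b c h1 h2 h3.
  by apply: (le_trans h1); rewrite ler_pM2l ?divr_gt0// (le_trans h2).
have mark : I0 * (tau * p ^+ 2) / q <= eps / 8.
  have s0 : 0 < tau * p ^+ 2 by rewrite mulr_gt0 ?exprn_gt0.
  rewrite ler_pdivrMr// /q [leRHS]mulrA ler_pM2r// /M2 mulrDr mulr1.
  rewrite (_ : eps / 8 * (8 * I0 / eps) = I0); last by field; rewrite gt_eqF.
  by rewrite lerDr divr_ge0 ?ltW.
by do !apply: lerD => //; apply: cheb; [exact: geq_minl | exact: geq_minr].
Qed.
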